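(* Let $(W,S)$ be a Coxeter system, $\mathfrak{h}^*$ its geometric representation, $R=\operatorname{Sym}(\mathfrak{h}^* )$, and $H=n\mathcal{H}$ the associated nil Hecke algebra with its Hopf algebroid structure over $R$ described in the context. Then $H$ is a Hopf algebroid without an antipode. More precisely, $$\operatorname{red}_H\neq(\mathrm{id}_H\otimes S_H)\circ\Delta$$ for any $k$-algebra morphism $S_H\colon H\to H^{\mathrm{op}}$ which is the identity on $R$.
   Context: Ground field $k=\mathbb{R}$. All algebras are associative and unital, and algebra morphisms are unital. **Coxeter system and geometric representation.** $(W,S)$ is a Coxeter system: $W=\langle s\in S\mid s^2=1,\ (st)^{m_{st}}=1 \text{ for } s\neq t\rangle$, where $m_{st}=m_{ts}=\operatorname{ord}(st)\ge 2$ may be infinite (then no relation is imposed). Let $\mathfrak{h}^*=\bigoplus_{s\in S}\mathbb{R}\alpha_s$ with symmetric bilinear form $(\alpha_s,\alpha_t)=-\cos(\pi/m_{st})$, where $m_{ss}=1$ and $\pi/\infty=0$. For $\lambda\in\mathfrak{h}^*$ put $\langle\lambda,\alpha_s^\vee\rangle=\frac{2(\lambda,\alpha_s)}{(\alpha_s,\alpha_s)}$. The formula $s(\lambda)=\lambda-\langle\lambda,\alpha_s^\vee\rangle\alpha_s$ defines a faithful representation of $W$ on $\mathfrak{h}^*$ (the geometric representation), hence an action of $W$ on $R=\operatorname{Sym}(\mathfrak{h}^* )$ by algebra automorphisms. **Nil Hecke algebra.** $n\mathcal{H}$ is the $k$-algebra generated by the vector space $\mathfrak{h}^*$ and elements $\partial_s$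 ($s\in S$) subject to: $\lambda\mu=\mu\lambda$ for $\lambda,\mu\in\mathfrak{h}^*$; $\partial_s\lambda=s(\lambda)\partial_s+\langle\lambda,\alpha_s^\vee\rangle$; $\partial_s^2=0$; and $\partial_s\partial_t\partial_s\cdots=\partial_t\partial_s\partial_t\cdots$ ($m_{st}$ factors on each side) for $s\ne t$ with $m_{st}<\infty$. It is known that $R$ embeds in $n\mathcal{H}$ and that $s\mapsto 1-\alpha_s\partial_s$ embeds $W$ in $n\mathcal{H}$; we write $s=1-\alpha_s\partial_s\in n\mathcal{H}$. $n\mathcal{H}$ acts faithfully on $R$ via $\rho_{n\mathcal{H}}$: $\lambda$ acts by multiplication and $\partial_s$ acts by $f\mapsto\frac{f-s(f)}{\alpha_s}$. **Tensor products.** For a $k$-algebra $H$ containing the commutative $k$-algebra $R$: $H\otimes H$ denotes the tensor product over $R$ of two copies of $H$ regarded as left $R$-modules ($rh\otimes h'=h\otimes rh'$), and $H\boxtimes H$ denotes the balanced tensor product ($hr\boxtimes h'=h\boxtimes rh'$). $H^{\mathrm{op}}$ is $H$ with the same $R$-bimodule structure and the opposite product, so $H\boxtimes H^{\mathrm{op}}=H\boxtimes H$ as a vector space. The Takeuchi products $H\times_R H=\{\sum_i h_i\otimes h_i'\in H\otimes H\mid \forall r\in R:\sum_i h_ir\otimes h_i'=\sum_i h_i\otimes h_i'r\}$ and $H\times_R H^{\mathrm{op}}=\{\sum_i h_i\boxtimes h_i'\in H\boxtimes H^{\mathrm{op}}\mid \forall r\in R:\sum_i rh_i\boxtimes h_i'=\sum_i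 h_i\boxtimes h_i'r\}$ (with $h_i'r$ the product in $H$) are algebras under componentwise multiplication (in the second, with the opposite product in the second factor). **Hopf algebroids.** $H$ is a (left) bialgebroid over $R$ if it is equipped with left $R$-linear maps $\Delta\colon H\to H\otimes H$ and $\varepsilon\colon H\to R$ such that $(H,\Delta,\varepsilon)$ is a coassociative counital coalgebra in left $R$-modules, $\Delta$ maps into $H\times_R H$ and is a $k$-algebra morphism to it, and $h\mapsto(r\mapsto\varepsilon(hr))$ is a representation of $H$ on $R$ restricting to the regular representation of $R$. It is a Hopf algebroid if the Galois map $\operatorname{Gal}_H\colon H\boxtimes H\to H\otimes H$, $h\boxtimes h'\mapsto h_{(1)}\otimes h_{(2)}h'$ (Sweedler notation $\Delta(h)=h_{(1)}\otimes h_{(2)}$), is bijective; then $\operatorname{red}_H\colon H\to H\boxtimes H$ is defined by $\operatorname{red}_H(h)=\operatorname{Gal}_H^{-1}(h\otimes 1)$. An antipode would be a morphism $S_H\colon H\to H^{\mathrm{op}}$ that is the identity on $R$ and induces $\operatorname{red}_H$, meaning $\operatorname{red}_H=(\mathrm{id}_H\otimes S_H)\circ\Delta$, in Sweedler notation $\operatorname{red}_H(h)=h_{(1)}\boxtimes S_H(h_{(2)})$. **Structure on the nil Hecke algebra.** For $H=n\mathcal{H}$ the comultiplication is the algebra morphism $\Delta\colon H\to H\times_R H$ with $\Delta(\lambda)=\lambda\cdot1\otimes1$ and $\Delta(\partial_s)=\partial_s\otimes s+1\otimes\partial_s=\partial_s\otimes 1+s\otimes\partial_s$, and the counit is $\varepsilon(h)=\rho_{n\mathcal{H}}(h)(1)\in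 R$. The map $\operatorname{red}_H$ is the algebra morphism $H\to H\times_R H^{\mathrm{op}}$ with $\operatorname{red}_H(\lambda)=\lambda1\boxtimes1$ and $\operatorname{red}_H(\partial_s)=\partial_s\boxtimes s+1\boxtimes\partial_s=\partial_s\boxtimes1-s\boxtimes\partial_s$.
   Formalization: The set S of generators is assumed nonempty: for S empty, W is trivial, H = R = k, and the identity map is an antipode, so the claim fails in that case. *)

(* Defs.v *)
From HB Require Import structures.
From mathcomp Require Import all_boot all_order all_algebra finmap.
From mathcomp Require Import boolp reals trigo.
From mathcomp.multinomials Require Import monalg.

Set Implicit Arguments.
Unset Strict Implicit.
Unset Printing Implicit Defensive.

Import GRing.Theory.
Local Open Scope ring_scope.
Local Open Scope quotient_scope.

Inductive alg_term (k X : Type) : Type :=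
| TVar of X
| TConst of k
| TAdd of alg_term k X & alg_term k X
| TMul of alg_term k X & alg_term k X.
Arguments TVar {k X}.
Arguments TConst {k X}.
Arguments TAdd {k X}.
Arguments TMul {k X}.

HB.instance Definition _ (k X : Type) := gen_eqMixin (alg_term k X).
HB.instance Definition _ (k X : Type) := gen_choiceMixin (alg_term k X).

Inductive alg_eq (k : comNzRingType) (X : Type)
    (rel : alg_term k X -> alg_term k X -> Prop) :
    alg_term k X -> alg_term k X -> Prop :=
| AE_rel a b : rel a b -> alg_eq rel a b
| AE_refl a : alg_eq rel a a
| AE_sym a b : alg_eq rel a b -> alg_eq rel b a
| AE_trans a b c : alg_eq rel a b -> alg_eq rel b c -> alg_eq rel a c
| AE_add a a' b b' : alg_eq rel a a' -> alg_eq rel b b' ->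
    alg_eq rel (TAdd a b) (TAdd a' b')
| AE_mul a a' b b' : alg_eq rel a a' -> alg_eq rel b b' ->
    alg_eq rel (TMul a b) (TMul a' b')
| AE_addA a b c : alg_eq rel (TAdd a (TAdd b c)) (TAdd (TAdd a b) c)
| AE_addC a b : alg_eq rel (TAdd a b) (TAdd b a)
| AE_add0 a : alg_eq rel (TAdd (TConst 0) a) a
| AE_addN a : alg_eq rel (TAdd (TMul (TConst (-1)) a) a) (TConst 0)
| AE_mulA a b c : alg_eq rel (TMul a (TMul b c)) (TMul (TMul a b) c)
| AE_mul1 a : alg_eq rel (TMul (TConst 1) a) a
| AE_mulDl a b c :
    alg_eq rel (TMul (TAdd a b) c) (TAdd (TMul a c) (TMul b c))
| AE_mulDr a b c :
    alg_eq rel (TMul a (TAdd b c)) (TAdd (TMul a b) (TMul a c))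
| AE_constD x y :
    alg_eq rel (TConst (x + y)) (TAdd (TConst x) (TConst y))
| AE_constM x y :
    alg_eq rel (TConst (x * y)) (TMul (TConst x) (TConst y))
| AE_constC x a :
    alg_eq rel (TMul (TConst x) a) (TMul a (TConst x)).

Section PresentedAlgebra.
Variables (k : comNzRingType) (X : Type).
Variable rel : alg_term k X -> alg_term k X -> Prop.
Local Notation E := (alg_eq rel).

Definition alg_eqb : ssrbool.rel (alg_term k X) := fun a b => `[< E a b >].

Lemma alg_eqb_refl : reflexive alg_eqb.
Proof. by move=> a; apply/asboolP; exact: AE_refl. Qed.

Lemma alg_eqb_sym : symmetric alg_eqb.
Proof. by move=> a b; apply/asboolP/asboolP; exact: AE_sym. Qed.

Lemma alg_eqb_trans : transitive alg_eqb.
Proof.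
by move=> b a c /asboolP ab /asboolP bc; apply/asboolP; exact: AE_trans ab bc.
Qed.

Definition alg_equiv := EquivRel alg_eqb alg_eqb_refl alg_eqb_sym alg_eqb_trans.

Definition presented_alg := {eq_quot alg_equiv}.

HB.instance Definition _ := Choice.on presented_alg.

Definition pres_pi (a : alg_term k X) : presented_alg := \pi_({eq_quot alg_equiv}) a.
Definition pres_repr (x : presented_alg) : alg_term k X :=
  repr (x : {eq_quot alg_equiv}).

Lemma pres_reprK x : pres_pi (pres_repr x) = x.
Proof. exact: (@reprK _ {eq_quot alg_equiv}). Qed.

Lemma pres_piP a b : pres_pi a = pres_pi b <-> E a b.
Proof.
split=> [/eqmodP /asboolP //|ab]; apply/eqmodP.
by apply/asboolP.
Qed.

Lemma pres_repr_pi a : E (pres_repr (pres_pi a)) a.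
Proof. by apply/pres_piP; rewrite pres_reprK. Qed.

Lemma pres_ind (P : presented_alg -> Prop) :
  (forall a, P (pres_pi a)) -> forall x, P x.
Proof. by move=> h x; rewrite -[x]pres_reprK. Qed.

Definition pres_add (x y : presented_alg) :=
  pres_pi (TAdd (pres_repr x) (pres_repr y)).
Definition pres_mul (x y : presented_alg) :=
  pres_pi (TMul (pres_repr x) (pres_repr y)).
Definition pres_const (c : k) := pres_pi (TConst c).
Definition pres_opp (x : presented_alg) := pres_mul (pres_const (-1)) x.

Lemma pres_addE a b : pres_add (pres_pi a) (pres_pi b) = pres_pi (TAdd a b).
Proof. by apply/pres_piP; apply: AE_add; exact: pres_repr_pi. Qed.

Lemma pres_mulE a b : pres_mul (pres_pi a) (pres_pi b) = pres_pi (TMul a b).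
Proof. by apply/pres_piP; apply: AE_mul; exact: pres_repr_pi. Qed.

Lemma pres_addA : associative pres_add.
Proof.
elim/pres_ind=> a; elim/pres_ind=> b; elim/pres_ind=> c.
by rewrite !pres_addE; apply/pres_piP; exact: AE_addA.
Qed.

Lemma pres_addC : commutative pres_add.
Proof.
elim/pres_ind=> a; elim/pres_ind=> b.
by rewrite !pres_addE; apply/pres_piP; exact: AE_addC.
Qed.

Lemma pres_add0 : left_id (pres_const 0) pres_add.
Proof.
elim/pres_ind=> a.
by rewrite !pres_addE; apply/pres_piP; exact: AE_add0.
Qed.

Lemma pres_mulA : associative pres_mul.
Proof.
elim/pres_ind=> a; elim/pres_ind=> b; elim/pres_ind=> c.
by rewrite !pres_mulE; apply/pres_piP; exact: AE_mulA.
Qed.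

Lemma pres_mul1 : left_id (pres_const 1) pres_mul.
Proof.
elim/pres_ind=> a.
by rewrite !pres_mulE; apply/pres_piP; exact: AE_mul1.
Qed.

Lemma pres_constC c x : pres_mul (pres_const c) x = pres_mul x (pres_const c).
Proof.
elim/pres_ind: x => a.
by rewrite !pres_mulE; apply/pres_piP; exact: AE_constC.
Qed.

Lemma pres_mulr1 : right_id (pres_const 1) pres_mul.
Proof. by move=> x; rewrite -pres_constC pres_mul1. Qed.

Lemma pres_mulDl : left_distributive pres_mul pres_add.
Proof.
elim/pres_ind=> a; elim/pres_ind=> b; elim/pres_ind=> c.
rewrite !(pres_addE, pres_mulE); apply/pres_piP; exact: AE_mulDl.
Qed.

Lemma pres_mulDr : right_distributive pres_mul pres_add.
Proof.
elim/pres_ind=> a; elim/pres_ind=> b; elim/pres_ind=> c.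
rewrite !(pres_addE, pres_mulE); apply/pres_piP; exact: AE_mulDr.
Qed.

Lemma pres_constD x y : pres_const (x + y) = pres_add (pres_const x) (pres_const y).
Proof. by rewrite pres_addE; apply/pres_piP; exact: AE_constD. Qed.

Lemma pres_constM x y : pres_const (x * y) = pres_mul (pres_const x) (pres_const y).
Proof. by rewrite pres_mulE; apply/pres_piP; exact: AE_constM. Qed.

Lemma pres_addN : left_inverse (pres_const 0) pres_opp pres_add.
Proof.
elim/pres_ind=> a; rewrite /pres_opp pres_mulE pres_addE.
by apply/pres_piP; exact: AE_addN.
Qed.

HB.instance Definition _ := GRing.isZmodule.Build presented_alg
  pres_addA pres_addC pres_add0 pres_addN.
HB.instance Definition _ := GRing.Zmodule_isPzRing.Build presented_alg
  pres_mulA pres_mul1 pres_mulr1 pres_mulDl pres_mulDr.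

Definition pres_scale (c : k) (x : presented_alg) := pres_mul (pres_const c) x.

Lemma pres_scaleA a b x :
  pres_scale a (pres_scale b x) = pres_scale (a * b) x.
Proof. by rewrite /pres_scale pres_mulA -pres_constM. Qed.

Lemma pres_scale1 : left_id 1 pres_scale.
Proof. exact: pres_mul1. Qed.

Lemma pres_scaleDr : right_distributive pres_scale +%R.
Proof. by move=> c x y; exact: pres_mulDr. Qed.

Lemma pres_scaleDl x : {morph pres_scale^~ x : a b / a + b}.
Proof. by move=> a b; rewrite /pres_scale pres_constD; exact: pres_mulDl. Qed.

HB.instance Definition _ := GRing.Zmodule_isLmodule.Build k presented_alg
  pres_scaleA pres_scale1 pres_scaleDr pres_scaleDl.

Lemma pres_scalerAl (c : k) (x y : presented_alg) : c *: (x * y) = (c *: x) * y.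
Proof. exact: pres_mulA. Qed.

Lemma pres_scalerAr (c : k) (x y : presented_alg) : c *: (x * y) = x * (c *: y).
Proof.
rewrite pres_scalerAl; transitivity ((x * pres_const c) * y); last first.
  by rewrite -mulrA.
by congr (_ * y); exact: pres_constC.
Qed.

End PresentedAlgebra.

(* [U] and [V] are abelian groups with actions of [R]; the side on which [R]
   acts is part of the data, so that the same construction yields both
   [H (x) H] and [H [x] H] below. *)
Section Tensor.
Variables (R : Type) (U V : zmodType).
Variables (actU : R -> {additive U -> U}) (actV : R -> {additive V -> V}).

(* The formal sum of the pure tensors in [s] equals the one for [t]. *)
Inductive tens_eq : seq (U * V) -> seq (U * V) -> Prop :=
| TE_refl s : tens_eq s s
| TE_sym s t : tens_eq s t -> tens_eq t s
| TE_trans s t u : tens_eq s t -> tens_eq t u -> tens_eq s u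
| TE_cat s s' t t' : tens_eq s s' -> tens_eq t t' -> tens_eq (s ++ t) (s' ++ t')
| TE_catC s t : tens_eq (s ++ t) (t ++ s)
| TE_zero v : tens_eq [:: (0, v)] [::]
| TE_addl u u' v : tens_eq [:: (u + u', v)] [:: (u, v); (u', v)]
| TE_addr u v v' : tens_eq [:: (u, v + v')] [:: (u, v); (u, v')]
| TE_bal r u v : tens_eq [:: (actU r u, v)] [:: (u, actV r v)].

Definition tens_eqb : ssrbool.rel (seq (U * V)) := fun s t => `[< tens_eq s t >].

Lemma tens_eqb_refl : reflexive tens_eqb.
Proof. by move=> s; apply/asboolP; exact: TE_refl. Qed.

Lemma tens_eqb_sym : symmetric tens_eqb.
Proof. by move=> s t; apply/asboolP/asboolP; exact: TE_sym. Qed.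

Lemma tens_eqb_trans : transitive tens_eqb.
Proof.
by move=> t s u /asboolP st /asboolP tu; apply/asboolP; exact: TE_trans st tu.
Qed.

Definition tens_equiv :=
  EquivRel tens_eqb tens_eqb_refl tens_eqb_sym tens_eqb_trans.

Definition tensor := {eq_quot tens_equiv}.

HB.instance Definition _ := Choice.on tensor.

Definition tens_pi (s : seq (U * V)) : tensor := \pi_({eq_quot tens_equiv}) s.
Definition tens_repr (x : tensor) : seq (U * V) :=
  repr (x : {eq_quot tens_equiv}).

Lemma tens_reprK x : tens_pi (tens_repr x) = x.
Proof. exact: (@reprK _ {eq_quot tens_equiv}). Qed.

Lemma tens_piP s t : tens_pi s = tens_pi t <-> tens_eq s t.
Proof.
by split=> [/eqmodP /asboolP //|st]; apply/eqmodP; apply/asboolP.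
Qed.

Lemma tens_repr_pi s : tens_eq (tens_repr (tens_pi s)) s.
Proof. by apply/tens_piP; rewrite tens_reprK. Qed.

Lemma tens_ind (P : tensor -> Prop) :
  (forall s, P (tens_pi s)) -> forall x, P x.
Proof. by move=> h x; rewrite -[x]tens_reprK. Qed.

Definition opp_terms (s : seq (U * V)) := [seq (- p.1, p.2) | p <- s].

Lemma tens_eq_opp s t : tens_eq s t -> tens_eq (opp_terms s) (opp_terms t).
Proof.
elim=> {s t} /=.
- by move=> s; exact: TE_refl.
- by move=> s t _; exact: TE_sym.
- by move=> s t u _ st _; exact: TE_trans.
- by move=> s s' t t' _ ss _ tt; rewrite /opp_terms !map_cat; exact: TE_cat.
- by move=> s t; rewrite /opp_terms !map_cat; exact: TE_catC.
- by move=> v; rewrite oppr0; exact: TE_zero.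
- by move=> u u' v; rewrite opprD; exact: TE_addl.
- by move=> u v v'; exact: TE_addr.
- by move=> r u v; rewrite -raddfN; exact: TE_bal.
Qed.

Definition tens_add (x y : tensor) := tens_pi (tens_repr x ++ tens_repr y).
Definition tens_opp (x : tensor) := tens_pi (opp_terms (tens_repr x)).

Lemma tens_addE s t : tens_add (tens_pi s) (tens_pi t) = tens_pi (s ++ t).
Proof. by apply/tens_piP; apply: TE_cat; exact: tens_repr_pi. Qed.

Lemma tens_oppE s : tens_opp (tens_pi s) = tens_pi (opp_terms s).
Proof. by apply/tens_piP; apply: tens_eq_opp; exact: tens_repr_pi. Qed.

Lemma tens_addA : associative tens_add.
Proof.
elim/tens_ind=> s; elim/tens_ind=> t; elim/tens_ind=> u.
by rewrite !tens_addE catA.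
Qed.

Lemma tens_addC : commutative tens_add.
Proof.
elim/tens_ind=> s; elim/tens_ind=> t.
by rewrite !tens_addE; apply/tens_piP; exact: TE_catC.
Qed.

Lemma tens_add0 : left_id (tens_pi [::]) tens_add.
Proof. by elim/tens_ind=> s; rewrite tens_addE. Qed.

Lemma tens_addN : left_inverse (tens_pi [::]) tens_opp tens_add.
Proof.
elim/tens_ind=> s; rewrite tens_oppE tens_addE; apply/tens_piP.
elim: s => [|[u v] s IHs] /=; first exact: TE_refl.
have swap : tens_eq (((- u, v) :: opp_terms s) ++ (u, v) :: s)
    ([:: (- u, v); (u, v)] ++ (opp_terms s ++ s)).
  rewrite (_ : _ ++ _ = [:: (- u, v)] ++ ((opp_terms s ++ [:: (u, v)]) ++ s)).
    rewrite (_ : [:: _; _] ++ _ =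
      [:: (- u, v)] ++ (([:: (u, v)] ++ opp_terms s) ++ s)) //.
    apply: TE_cat; first exact: TE_refl.
    by apply: TE_cat; [exact: TE_catC|exact: TE_refl].
  by rewrite -catA.
apply: TE_trans swap _; rewrite -[X in tens_eq _ X]cat0s.
apply: TE_cat IHs; apply: TE_trans (TE_zero v).
by rewrite -(addNr u); apply: TE_sym; exact: TE_addl.
Qed.

HB.instance Definition _ := GRing.isZmodule.Build tensor
  tens_addA tens_addC tens_add0 tens_addN.

Definition pure (u : U) (v : V) : tensor := tens_pi [:: (u, v)].

Lemma tens_pi_sum s : tens_pi s = \sum_(p <- s) pure p.1 p.2.
Proof.
elim: s => [|[u v] s IHs]; first by rewrite big_nil.
by rewrite big_cons -IHs [RHS]tens_addE.
Qed.

Definition balanced (Z : zmodType) (f : U -> V -> Z) : Prop :=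
  [/\ forall v, {morph f^~ v : u u' / u + u'},
      forall u, {morph f u : v v' / v + v'}
    & forall r u v, f (actU r u) v = f u (actV r v)].

(* The additive map induced by [f] when [f] is balanced, see [tlift_pure] and
   [tlift_add]; it depends on the choice of representatives otherwise. *)
Definition tlift (Z : zmodType) (f : U -> V -> Z) (x : tensor) : Z :=
  \sum_(p <- tens_repr x) f p.1 p.2.

Section Lift.
Variables (Z : zmodType) (f : U -> V -> Z).
Hypothesis f_bal : balanced f.

Lemma tens_eq_sum s t : tens_eq s t ->
  \sum_(p <- s) f p.1 p.2 = \sum_(p <- t) f p.1 p.2.
Proof.
have [fDl fDr fB] := f_bal.
have f0 v : f 0 v = 0.
  by apply: (@addrI _ (f 0 v)); rewrite -fDl !addr0.
elim=> {s t} //=.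
- by move=> s t u _ -> _ ->.
- by move=> s s' t t' _ e1 _ e2; rewrite !big_cat /= e1 e2.
- by move=> s t; rewrite !big_cat /= addrC.
- by move=> v; rewrite big_seq1 big_nil f0.
- by move=> u u' v; rewrite big_seq1 !big_cons big_nil addr0 fDl.
- by move=> u v v'; rewrite big_seq1 !big_cons big_nil addr0 fDr.
- by move=> r u v; rewrite !big_seq1 fB.
Qed.

Lemma tlift_pi s : tlift f (tens_pi s) = \sum_(p <- s) f p.1 p.2.
Proof. by apply: tens_eq_sum; exact: tens_repr_pi. Qed.

Lemma tlift_pure u v : tlift f (pure u v) = f u v.
Proof. by rewrite tlift_pi big_seq1. Qed.

Lemma tlift_add : {morph tlift f : x y / x + y}.
Proof.
elim/tens_ind=> s; elim/tens_ind=> t.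
by rewrite [in LHS]/GRing.add /= tens_addE !tlift_pi big_cat.
Qed.

End Lift.

Lemma pure_balanced : balanced pure.
Proof.
split=> [v u u'|u v v'|r u v].
- by rewrite [RHS]tens_addE; apply/tens_piP; exact: TE_addl.
- by rewrite [RHS]tens_addE; apply/tens_piP; exact: TE_addr.
- by apply/tens_piP; exact: TE_bal.
Qed.

End Tensor.

Section HopfAlgebroid.
Variables (R : comPzRingType) (H : pzRingType) (iota : {rmorphism R -> H}).

Definition lact (r : R) (h : H) : H := iota r * h.
Definition ract (r : R) (h : H) : H := h * iota r.

Lemma lact_is_zmod r : zmod_morphism (lact r).
Proof. by move=> x y; exact: mulrBr. Qed.
HB.instance Definition _ r := GRing.isZmodMorphism.Build H H (lact r) (lact_is_zmod r).

Lemma ract_is_zmod r : zmod_morphism (ract r).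
Proof. by move=> x y; exact: mulrBl. Qed.
HB.instance Definition _ r := GRing.isZmodMorphism.Build H H (ract r) (ract_is_zmod r).

(* [HoH] is H (x) H, with r h (x) h' = h (x) r h';
   [HbH] is the balanced H [x] H, with h r [x] h' = h [x] r h'. *)
Definition HoH : zmodType := tensor (fun r => lact r) (fun r => lact r).
Definition HbH : zmodType := tensor (fun r => ract r) (fun r => lact r).

Definition otens (h h' : H) : HoH := pure _ _ h h'.
Definition btens (h h' : H) : HbH := pure _ _ h h'.

Definition lactT (r : R) : HoH -> HoH := tlift (fun a b => otens (lact r a) b).

Lemma lactT_balanced r :
  balanced (fun r => lact r) (fun r => lact r) (fun a b => otens (lact r a) b).
Proof.
have [oDl oDr oB] := pure_balanced (fun r => lact r) (fun r => lact r).
split=> [v u u'|u v v'|r' u v]; rewrite /otens.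
- by rewrite raddfD oDl.
- by rewrite oDr.
- by rewrite -oB /= /lact !mulrA -!rmorphM mulrC.
Qed.

Lemma lactT_is_zmod r : zmod_morphism (lactT r).
Proof.
have h := tlift_add (lactT_balanced r).
move=> x y; apply: (@addIr _ (lactT r y)).
by rewrite /lactT -h !subrK.
Qed.
HB.instance Definition _ r :=
  GRing.isZmodMorphism.Build HoH HoH (lactT r) (lactT_is_zmod r).

Definition HoHoH : zmodType := tensor (fun r => lactT r) (fun r => lact r).
Definition otensT (x : HoH) (h : H) : HoHoH := pure _ _ x h.

Definition in_takeuchi (x : HoH) : Prop := forall r : R,
  tlift (fun a b => otens (a * iota r) b) x =
  tlift (fun a b => otens a (b * iota r)) x.

(* Componentwise product. For [x] in the Takeuchi product the outer function is
   balanced, so that this is the product of [x] and [y] for every [y]. *)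
Definition omul (x y : HoH) : HoH :=
  tlift (fun c d => tlift (fun a b => otens (a * c) (b * d)) x) y.

Section Structure.
Variables (Delta : H -> HoH) (eps : H -> R).

Definition Delta_id : HoH -> HoHoH := tlift (fun a b => otensT (Delta a) b).

(* [id (x) Delta], composed with the identification of H (x) (H (x) H) with
   (H (x) H) (x) H. *)
Definition id_Delta : HoH -> HoHoH :=
  tlift (fun a b => tlift (fun c d => otensT (otens a c) d) (Delta b)).

Record bialgebroid : Prop := {
  iota_inj : injective iota;
  DeltaD : {morph Delta : h h' / h + h'};
  DeltaZ : forall r h, Delta (iota r * h) = lactT r (Delta h);
  epsD : {morph eps : h h' / h + h'};
  epsZ : forall r h, eps (iota r * h) = r * eps h;
  coassociative : forall h, Delta_id (Delta h) = id_Delta (Delta h);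
  counital_l : forall h, tlift (fun a b => iota (eps a) * b) (Delta h) = h;
  counital_r : forall h, tlift (fun a b => iota (eps b) * a) (Delta h) = h;
  Delta_takeuchi : forall h, in_takeuchi (Delta h);
  Delta1 : Delta 1 = otens 1 1;
  DeltaM : forall h h', Delta (h * h') = omul (Delta h) (Delta h');
  eps_repr1 : forall r, eps (1 * iota r) = r;
  eps_reprM : forall h h' r,
    eps ((h * h') * iota r) = eps (h * iota (eps (h' * iota r)));
  eps_regular : forall r' r, eps (iota r' * iota r) = r' * r
}.

(* Sends h [x] h' to h_(1) (x) h_(2) h'. *)
Definition Gal : HbH -> HoH :=
  tlift (fun h h' => tlift (fun a b => otens a (b * h')) (Delta h)).

Definition hopf_algebroid : Prop := bialgebroid /\ bijective Gal.

Definition is_red (red : H -> HbH) : Prop :=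
  forall h, Gal (red h) = otens h 1.

(* The value h_(1) [x] S(h_(2)) depends on the chosen expansion of Delta h as a
   sum of pure tensors: r h (x) h' = h (x) r h', whereas r h [x] S(h') and
   h [x] S(r h') = h [x] S(h') r differ in general. Here S is said to induce
   [red] when some expansion of each Delta h yields red h; this is the weakest
   reading, so that its negation covers every choice of expansions. *)
Definition induces_red (S : H -> H) (red : H -> HbH) : Prop :=
  forall h, exists s : seq (H * H),
    Delta h = \sum_(p <- s) otens p.1 p.2 /\
    red h = \sum_(p <- s) btens p.1 (S p.2).

End Structure.

End HopfAlgebroid.

(* [sigma] lists the elements of S in W, and [m s t] is the order of [st], with
   [m s t = 0] standing for infinite order ([0 %| n] means [n = 0]); the relation
   [(st) ^ m s t = 1] is then void. Injectivity of [sigma] excludes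
   [m s t = 1] for distinct s and t. *)
Definition coxeter_system (W : groupType) (S : choiceType) (sigma : S -> W)
    (m : S -> S -> nat) : Prop :=
  [/\ injective sigma,
      forall s t (n : nat), ((sigma s * sigma t) ^+ n = 1)%g <-> (m s t %| n)%N,
      forall s, (sigma s ^+ 2 = 1)%g
    & forall (G : groupType) (f : S -> G),
        (forall s, f s ^+ 2 = 1)%g ->
        (forall s t, s <> t -> (f s * f t) ^+ m s t = 1)%g ->
        exists! phi : W -> G,
          {morph phi : x y / (x * y)%g} /\ forall s, phi (sigma s) = f s].

Section NilHecke.
Variables (k : realType) (S : choiceType) (m : S -> S -> nat).

Definition hstar := {malg k[S]}.
Definition alpha (s : S) : hstar := << s >>.

(* For [m s t = 0] the library computes [pi / 0 = 0], which is the convention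
   pi / oo = 0. *)
Definition form (u v : hstar) : k :=
  \sum_(s <- msupp u) \sum_(t <- msupp v)
    u@_s * v@_t * - cos (pi / (m s t)%:R).

Definition pairing (u : hstar) (s : S) : k :=
  2%:R * form u (alpha s) / form (alpha s) (alpha s).

Definition srefl (s : S) (u : hstar) : hstar := u - pairing u s *: alpha s.

(* Sym h^*, the polynomial algebra on the basis S of h^*. *)
Definition Sym := {malg k[{cmonom S}]}.

Definition Sym_of (u : hstar) : Sym :=
  \sum_(s <- msupp u) << u@_s *g ucm s >>.

Definition Sym_act (s : S) : Sym -> Sym :=
  mmap (@malgC {cmonom S} k)
    (fun e : {cmonom S} => \prod_(t <- finsupp e) Sym_of (srefl s (alpha t)) ^+ e t).

Inductive nilH_gen : Type := GenV of hstar | GenD of S.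

Local Notation term := (alg_term k nilH_gen).
Local Notation tV u := (TVar (GenV u) : term).
Local Notation tD s := (TVar (GenD s) : term).

Fixpoint braid_word (n : nat) (s t : S) : term :=
  if n is n'.+1 then TMul (tD s) (braid_word n' t s) else TConst 1.

Inductive nilH_rel : term -> term -> Prop :=
| NR_lin c u v : nilH_rel (tV (c *: u + v)) (TAdd (TMul (TConst c) (tV u)) (tV v))
| NR_comm u v : nilH_rel (TMul (tV u) (tV v)) (TMul (tV v) (tV u))
| NR_cross s u : nilH_rel (TMul (tD s) (tV u))
    (TAdd (TMul (tV (srefl s u)) (tD s)) (TConst (pairing u s)))
| NR_sq s : nilH_rel (TMul (tD s) (tD s)) (TConst 0)
| NR_braid s t : s <> t -> (0 < m s t)%N ->
    nilH_rel (braid_word (m s t) s t) (braid_word (m s t) t s).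

(* Only a [pzRingType] with a compatible [lmodType] structure, because [1 != 0]
   in [nilH] is not available at this point. *)
Definition nilH := presented_alg nilH_rel.
HB.instance Definition _ := GRing.PzRing.on nilH.
HB.instance Definition _ := GRing.Lmodule.on nilH.

Definition hV (u : hstar) : nilH := pres_pi nilH_rel (tV u).
Definition hD (s : S) : nilH := pres_pi nilH_rel (tD s).

Definition hmon (e : {cmonom S}) : nilH :=
  \prod_(t <- finsupp e) hV (alpha t) ^+ e t.

(* The algebra morphism Sym h^* -> nilH extending the inclusion of h^*, see
   [Sym_in_of]. *)
Definition Sym_in (f : Sym) : nilH := \sum_(e <- msupp f) f@_e *: hmon e.

Lemma hV_lin c u v : hV (c *: u + v) = c *: hV u + hV v.
Proof.
rewrite [RHS]/GRing.add /= [X in pres_add X _]/GRing.scale /= /pres_scale.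
rewrite pres_mulE pres_addE.
by apply/pres_piP; apply: AE_rel; exact: NR_lin.
Qed.
HB.instance Definition _ := GRing.isLinear.Build k hstar nilH *:%R hV hV_lin.

Lemma hV_comm u v : hV u * hV v = hV v * hV u.
Proof.
rewrite [LHS]pres_mulE [RHS]pres_mulE.
by apply/pres_piP; apply: AE_rel; exact: NR_comm.
Qed.

Lemma prod_perm_comm (A : pzRingType) (I : eqType) (F : I -> A) (r r' : seq I) :
  (forall i j, GRing.comm (F i) (F j)) -> perm_eq r r' ->
  \prod_(i <- r) F i = \prod_(i <- r') F i.
Proof.
move=> Fc; elim: r r' => [|x r IHr] r' rr'.
  by move: rr'; rewrite perm_sym => /perm_nilP ->.
have xr' : x \in r' by rewrite -(perm_mem rr') mem_head.
have prod_rem (s : seq I) : x \in s ->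
    \prod_(i <- s) F i = F x * \prod_(i <- rem x s) F i.
  elim: s => [//|y s IHs]; rewrite inE /= [y == x]eq_sym.
  case: eqVneq => [-> _|_ /= xs]; first by rewrite big_cons.
  by rewrite !big_cons IHs // !mulrA Fc.
rewrite big_cons (prod_rem _ xr') (IHr (rem x r')) //.
by rewrite -(perm_cons x); apply: (perm_trans rr'); exact: perm_to_rem.
Qed.

Lemma hmonEw (d : {fset S}) (e : {cmonom S}) : (finsupp e `<=` d)%fset ->
  hmon e = \prod_(t <- d) hV (alpha t) ^+ e t.
Proof.
move=> le_ed; transitivity
    (\prod_(t <- [seq t <- d | t \in finsupp e]) hV (alpha t) ^+ e t).
  apply: prod_perm_comm => [s t|].
    by apply/commrX/commr_sym/commrX; exact: hV_comm.
  apply: uniq_perm; rewrite ?filter_uniq ?fset_uniq // => t.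
  by rewrite mem_filter andb_idr // => /(fsubsetP le_ed).
rewrite big_filter big_mkcond; apply: eq_bigr => t _.
by case: ifPn => //; rewrite -cmE_eq0 => /eqP ->.
Qed.

Lemma hmon1 : hmon (onecm S) = 1.
Proof. by rewrite /hmon mdom1 big_seq_fset0. Qed.

Lemma hmonM e1 e2 : hmon (mulcm e1 e2) = hmon e1 * hmon e2.
Proof.
pose d := (finsupp e1 `|` finsupp e2)%fset.
rewrite (@hmonEw d) ?mdomD // (@hmonEw d e1) ?fsubsetUl //.
rewrite (@hmonEw d e2) ?fsubsetUr // -prodrM_comm.
  by apply: eq_bigr => t _; rewrite cmM exprD.
by move=> i j _ _; apply/commrX/commr_sym/commrX; exact: hV_comm.
Qed.

Lemma Sym_inEw (d : {fset {cmonom S}}) (f : Sym) : (msupp f `<=` d)%fset ->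
  Sym_in f = \sum_(e <- d) f@_e *: hmon e.
Proof.
move=> le_fd; rewrite /Sym_in (big_fset_incl _ le_fd) //= => e _.
by move/mcoeff_outdom => ->; rewrite scale0r.
Qed.

Lemma Sym_in_is_linear : linear Sym_in.
Proof.
move=> c f g; pose d := (msupp f `|` msupp g)%fset.
rewrite (@Sym_inEw d) ?(@Sym_inEw d f) ?(@Sym_inEw d g) ?fsubsetUl ?fsubsetUr //.
  rewrite scaler_sumr -big_split /=; apply: eq_bigr => e _.
  by rewrite mcoeffD mcoeffZ scalerDl scalerA.
apply: fsubset_trans (msuppD_le _ _) _.
by apply: fsetUSS => //; exact: msuppZ_le.
Qed.
HB.instance Definition _ := GRing.isLinear.Build k Sym nilH _ Sym_in Sym_in_is_linear.

Lemma Sym_inU c e : Sym_in << c *g e >> = c *: hmon e.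
Proof. by rewrite (Sym_inEw msuppU_le) big_seq_fset1 mcoeffUU. Qed.

Lemma Sym_in_is_monoid_morphism : monoid_morphism Sym_in.
Proof.
split=> [|f g]; first by rewrite Sym_inU hmon1 scale1r.
rewrite malgME raddf_sum mulr_suml; apply: eq_bigr => e1 _.
rewrite raddf_sum mulr_sumr; apply: eq_bigr => e2 _ /=.
rewrite Sym_inU hmonM -scalerA.
rewrite -[in RHS](@pres_scalerAl _ _ (@nilH_rel)) -[in RHS]pres_scalerAr.
by [].
Qed.
HB.instance Definition _ :=
  GRing.isMonoidMorphism.Build Sym nilH Sym_in Sym_in_is_monoid_morphism.

Lemma Sym_in_of u : Sym_in (Sym_of u) = hV u.
Proof.
rewrite raddf_sum [in RHS](monalgE u) raddf_sum; apply: eq_bigr => s _ /=.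
rewrite Sym_inU /hmon mdomU big_seq_fset1 cmUU expr1.
have -> : << u@_s *g s >> = u@_s *: alpha s.
  by apply/malgP => t; rewrite mcoeffZ !mcoeffU -mulr_natr mulr_natr; case: eqP => //; rewrite ?mulr1 ?mulr0.
by rewrite linearZ.
Qed.

(* The element s of W, viewed in the nil Hecke algebra. *)
Definition hW (s : S) : nilH := 1 - hV (alpha s) * hD s.

Record demazure_rep (rho : nilH -> Sym -> Sym) : Prop := {
  rho_linear : forall h, linear (rho h);
  rho_linear_l : forall f, linear (rho^~ f);
  rho1 : forall f, rho 1 f = f;
  rhoM : forall h h' f, rho (h * h') f = rho h (rho h' f);
  rhoV : forall u f, rho (hV u) f = Sym_of u * f;
  rhoD : forall s f, Sym_of (alpha s) * rho (hD s) f = f - Sym_act s f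
}.

Definition Sym_to_nilH : {rmorphism Sym -> nilH} := Sym_in.

Definition nilHoH : zmodType := HoH Sym_to_nilH.
Definition nilHbH : zmodType := HbH Sym_to_nilH.

Record nilH_comul (Delta : nilH -> nilHoH) : Prop := {
  comulV : forall u, Delta (hV u) = otens Sym_to_nilH (hV u) 1;
  comulD : forall s, Delta (hD s) =
    otens Sym_to_nilH (hD s) (hW s) + otens Sym_to_nilH 1 (hD s);
  comulD' : forall s, Delta (hD s) =
    otens Sym_to_nilH (hD s) 1 + otens Sym_to_nilH (hW s) (hD s)
}.

(* Delta and rho are determined by these conditions. *)
Definition nilH_hopf_algebroid
    (Delta : nilH -> nilHoH) (rho : nilH -> Sym -> Sym) : Prop :=
  [/\ demazure_rep rho, nilH_comul Delta
    & hopf_algebroid Delta (fun h => rho h 1)].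

(* A morphism of k-algebras from [nilH] to its opposite that is the identity on
   Sym h^*. *)
Record op_morphism_over_Sym (A : nilH -> nilH) : Prop := {
  op_linear : linear A;
  op1 : A 1 = 1;
  opM : forall h h', A (h * h') = A h' * A h;
  op_id : forall f, A (Sym_to_nilH f) = Sym_to_nilH f
}.

End NilHecke.

(* Main.v *)
Require Import Defs.
From HB Require Import structures.
From mathcomp Require Import all_boot all_order all_algebra finmap.
From mathcomp Require Import boolp reals trigo ring zify fraction.
From mathcomp.multinomials Require Import monalg.

(* Write D = D_s, alpha = alpha_s and s = 1 - alpha D.

   Existence. The tensor product over R of two H-modules is an H-module through
   D (a (x) b) = Da (x) b + sa (x) Db, and Delta h = h (1 (x) 1). The point is the
   braid relation on H (x) H. Applied to 1 (x) 1, both sides lie in the span of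
   the products u (x) v of words in the two given letters; acting on polynomials
   and multiplying, they become f (x) g |-> d_w (fg) for the two braid words w,
   which agree by the braid relation for Demazure operators. The words of the
   rank two nil Hecke algebra act by linearly independent operators, so this
   determines an element of the span. With tau the anti-automorphism of H that
   fixes R and all D, the map a (x) b |-> tau(a) (1 (x) b) is an involution, and it
   is the Galois map up to the bijection a [x] b |-> tau(a) (x) b.

   No antipode. Let A be an algebra morphism to the opposite algebra fixing R and
   X = A(D). Writing the operators in H as combinations of ring automorphisms of R
   with coefficients in Frac R, the coefficient tr of the identity vanishes on
   commutators with R. If A induced red, then D (x) 1 + s (x) D and
   D [x] 1 - s [x] D would give tr(D + sX) = tr(D - sD), that is, tr(Z) = 0 for
   Z = s(X + D). But alpha Z + 2s commutes with R, so it acts as multiplication by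
   a polynomial with constant term 2, which is its trace, while tr(s) = 0. *)

Set Implicit Arguments.
Unset Strict Implicit.
Unset Printing Implicit Defensive.

Import Order.TTheory GRing.Theory Num.Theory.
Local Open Scope ring_scope.

(** * Modules over presented algebras *)

Section TermAction.
Variables (k : comNzRingType) (X : Type) (T : zmodType).
Variables (C : k -> T -> T) (G : X -> T -> T).

Fixpoint term_op (a : alg_term k X) (v : T) : T :=
  match a with
  | TVar x => G x v
  | TConst c => C c v
  | TAdd a b => term_op a v + term_op b v
  | TMul a b => term_op a (term_op b v)
  end.

(** The ring axioms built into [alg_eq] hold for sums and composites of additive operators once
    scalars act additively, multiplicatively and centrally, so only [rel] has to be checked on the
    generators. *)
Record term_module (rel : alg_term k X -> alg_term k X -> Prop) : Prop := {
  tm_varD : forall x, {morph G x : u v / u + v};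
  tm_constD : forall c, {morph C c : u v / u + v};
  tm_const_add : forall c d v, C (c + d) v = C c v + C d v;
  tm_const_mul : forall c d v, C (c * d) v = C c (C d v);
  tm_const1 : forall v, C 1 v = v;
  tm_constC : forall c x v, C c (G x v) = G x (C c v);
  tm_rel : forall a b, rel a b -> term_op a =1 term_op b
}.

Variable rel : alg_term k X -> alg_term k X -> Prop.
Hypothesis mod : term_module rel.

Lemma term_opD a : {morph term_op a : u v / u + v}.
Proof.
elim: a => [x|c|a IHa b IHb|a IHa b IHb] u v /=.
- exact: (tm_varD mod).
- exact: (tm_constD mod).
- by rewrite IHa IHb addrACA.
- by rewrite IHb IHa.
Qed.

Lemma term_opC a c v : C c (term_op a v) = term_op a (C c v).
Proof.
elim: a v => [x|d|a IHa b IHb|a IHa b IHb] v /=.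
- exact: (tm_constC mod).
- by rewrite -!(tm_const_mul mod) mulrC.
- by rewrite (tm_constD mod) IHa IHb.
- by rewrite IHa IHb.
Qed.

Lemma tm_const0 v : C 0 v = 0.
Proof. by apply: (@addrI _ (C 0 v)); rewrite -(tm_const_add mod) !addr0. Qed.

Lemma alg_eq_term_op a b : alg_eq rel a b -> term_op a =1 term_op b.
Proof.
elim=> {a b} /=.
- exact: (tm_rel mod).
- by [].
- by move=> a b _ IH v; rewrite IH.
- by move=> a b c _ IH _ IH' v; rewrite IH.
- by move=> a a' b b' _ IHa _ IHb v; rewrite IHa IHb.
- by move=> a a' b b' _ IHa _ IHb v; rewrite IHa IHb.
- by move=> a b c v; rewrite addrA.
- by move=> a b v; rewrite addrC.
- by move=> a v; rewrite tm_const0 add0r.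
- move=> a v; rewrite -[X in _ + X](tm_const1 mod) -(tm_const_add mod).
  by rewrite addNr !tm_const0.
- by [].
- by move=> a v; rewrite (tm_const1 mod).
- by [].
- by move=> a b c v; rewrite term_opD.
- by move=> x y v; rewrite (tm_const_add mod).
- by move=> x y v; rewrite (tm_const_mul mod).
- by move=> x a v; rewrite term_opC.
Qed.

Definition pres_act (h : presented_alg rel) (v : T) : T := term_op (pres_repr h) v.

Lemma pres_act_pi a v : pres_act (pres_pi rel a) v = term_op a v.
Proof. by apply: alg_eq_term_op; exact: pres_repr_pi. Qed.

Lemma pres_actDr h : {morph pres_act h : u v / u + v}.
Proof. exact: term_opD. Qed.

Lemma pres_actDl h h' v : pres_act (h + h') v = pres_act h v + pres_act h' v.
Proof.
elim/pres_ind: h => a; elim/pres_ind: h' => b.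
by rewrite [_ + _ in LHS]pres_addE !pres_act_pi.
Qed.

Lemma pres_actM h h' v : pres_act (h * h') v = pres_act h (pres_act h' v).
Proof.
elim/pres_ind: h => a; elim/pres_ind: h' => b.
by rewrite [_ * _ in LHS]pres_mulE !pres_act_pi.
Qed.

Lemma pres_act1 v : pres_act 1 v = v.
Proof. by rewrite pres_act_pi /= (tm_const1 mod). Qed.

Lemma pres_actZ c h v : pres_act (c *: h) v = C c (pres_act h v).
Proof.
elim/pres_ind: h => a.
by rewrite [_ *: _ in LHS]pres_mulE !pres_act_pi.
Qed.

End TermAction.

Lemma presented_alg_ind (k : comNzRingType) (X : Type)
    (rel : alg_term k X -> alg_term k X -> Prop) (P : presented_alg rel -> Prop) :
  P 1 -> (forall x y, P x -> P y -> P (x + y)) ->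
  (forall c x, P x -> P (c *: x)) ->
  (forall g x, P x -> P (pres_pi rel (TVar g) * x)) -> forall x, P x.
Proof.
(* The claim is generalized from [x * 1] to [x * y] for every [y] with [P y]; a product of terms is
   then two successive uses of the hypothesis. *)
move=> P1 PD PZ PV x; rewrite -[x]mulr1; elim/pres_ind: x => a; move: 1 P1.
elim: a => [g|c|a IHa b IHb|a IHa b IHb] y Py.
- exact: PV.
- exact: PZ.
- rewrite -[pres_pi _ _]pres_addE; change (P ((pres_pi rel a + pres_pi rel b) * y)).
  by rewrite mulrDl; apply: PD; [exact: IHa|exact: IHb].
- rewrite -[pres_pi _ _]pres_mulE; change (P ((pres_pi rel a * pres_pi rel b) * y)).
  by rewrite -mulrA; apply: IHa; exact: IHb.
Qed.

(** * Polynomial algebras in any set of variables over a domain are domains *)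

Local Notation "1" := (@mone _) : monom_scope.
Local Notation "x * y" := (mmul x y) : monom_scope.

Lemma rmorph_mul_add_neq0 (A B : nzRingType) (phi : {rmorphism A -> B}) (a y c : A) :
  phi a = 0 -> phi c != 0 -> a * y + c != 0.
Proof.
move=> a0; apply: contraNneq => e.
by have := congr1 phi e; rewrite rmorphD rmorphM a0 mul0r add0r rmorph0 => ->.
Qed.

Section CmonomAlgebra.
Variables (k : idomainType) (S : choiceType).
Implicit Types (f g : {malg k[{cmonom S}]}) (e : {cmonom S}).

Lemma monalgUZ (K : choiceType) (c : k) (e : K) :
  << c *g e >> = c *: << e >> :> {malg k[K]}.
Proof.
apply/malgP => t; rewrite mcoeffZ !mcoeffU.
by case: eqP => _; rewrite ?(mulr1n, mulr0n) ?mulr1 ?mulr0.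
Qed.

(** Every monomial other than 1 is a variable times a monomial of smaller degree, so induction on
    the degree reaches it from the constants. *)
Lemma malg_cmonom_ind (P : {malg k[{cmonom S}]} -> Prop) :
  (forall f g, P f -> P g -> P (f + g)) -> (forall c, P c%:MP) ->
  (forall s f, P f -> P (<< ucm s >> * f)) -> forall f, P f.
Proof.
move=> PD PC PV f; rewrite (monalgE f).
apply: (big_ind P) => //; first by rewrite -malgC0E; exact: PC.
move=> e _; move: f@_e => c; have [n] := ubnP (mdeg e).
elim: n e => // n IHn e le_e.
have [->|e_neq1] := eqVneq e 1%M; first exact: PC.
have [s se] : exists s, s \in finsupp e.
  apply/fset0Pn; apply: contraNneq e_neq1 => e0.
  by rewrite -mdeg_eq0 mdegE e0 big_seq_fset0.
have es : e = (ucm s * divcm e (ucm s))%M.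
  apply/eqP/cmP => t; rewrite cmM divcmE ucmE subnKC //.
  by case: eqP => // <-; rewrite lt0n cmE_neq0.
have -> : << c *g e >> = << ucm s >> * << c *g divcm e (ucm s) >>.
  by rewrite [in LHS]es malgM_def fgmulUU mul1r.
apply: PV; apply: IHn; move: le_e; rewrite {1}es mdegM mdegU add1n ltnS.
exact.
Qed.

Lemma cmon_prodEw (A : comNzRingType) (F : S -> A) (d : {fset S}) e :
  (finsupp e `<=` d)%fset ->
  \prod_(t <- finsupp e) F t ^+ e t = \prod_(t <- d) F t ^+ e t.
Proof.
move=> le_ed; apply: big_fset_incl => // t _.
by rewrite -cmE_eq0 => /eqP ->.
Qed.

Definition cmon_prod (A : comNzRingType) (F : S -> A) e : A :=
  \prod_(t <- finsupp e) F t ^+ e t.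

Lemma cmon_prod_mmorphism (A : comNzRingType) (F : S -> A) :
  mmorphism (cmon_prod F).
Proof.
split=> [e1 e2|]; last by rewrite /cmon_prod mdom1 big_seq_fset0.
pose d := (finsupp e1 `|` finsupp e2)%fset.
rewrite /cmon_prod (cmon_prodEw _ (d := d)) ?mdomD //.
rewrite (cmon_prodEw _ (d := d) (e := e1)) ?fsubsetUl //.
rewrite (cmon_prodEw _ (d := d) (e := e2)) ?fsubsetUr // -big_split /=.
by apply: eq_bigr => t _; rewrite cmM exprD.
Qed.
HB.instance Definition _ (A : comNzRingType) (F : S -> A) :=
  isMultiplicative.Build {cmonom S} A (cmon_prod F) (cmon_prod_mmorphism F).

Definition wdeg (w : S -> nat) e := (\sum_(t <- finsupp e) w t * e t)%N.

(** When [N] exceeds the exponent of [s], the refined weight has [wdeg w e] and [e s] as quotient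
    and remainder modulo [N], so it remembers both. *)
Lemma wdeg_refine (w : S -> nat) N s e :
  wdeg (fun t => (N * w t + (t == s))%N) e = (N * wdeg w e + e s)%N.
Proof.
rewrite /wdeg big_distrr /= -[e s in RHS]mul1n.
have -> : (1 * e s)%N = (\sum_(t <- finsupp e) (t == s) * e t)%N.
  case: (mdomP e s) => se.
    rewrite (big_fsetD1 s) //= eqxx mul1n big_seq big1 ?addn0 ?mul1n // => t.
    by rewrite !inE => /andP[/negPf ->].
  rewrite muln0 big_seq big1 // => t te.
  by case: eqP se => // <-; rewrite te.
by rewrite -big_split /=; apply: eq_bigr => t _; rewrite mulnDl mulnA.
Qed.

(** Pairs are added one at a time. The weight found so far is refined by a variable [s] that occurs
    with different exponents in the new pair: the new pair is separated by remainders modulo [N],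
    the old ones by quotients. *)
Lemma exists_separating_weight (E : seq ({cmonom S} * {cmonom S})) :
  (forall p, p \in E -> p.1 != p.2) ->
  exists w, forall p, p \in E -> wdeg w p.1 != wdeg w p.2.
Proof.
elim: E => [_|q E IHE neqE]; first by exists (fun=> 0%N).
have [p pE|w neqw] := IHE; first by apply: neqE; rewrite inE pE orbT.
have [s neqs] : exists s, q.1 s != q.2 s.
  apply: contrapT => eqs; move: (neqE q (mem_head _ _)); apply/negP/negPn.
  by apply/cmP => s; apply/eqP/negPn/negP => neqs; apply: eqs; exists s.
pose N := (\sum_(p <- q :: E) (p.1 s + p.2 s)).+1.
have ltN p : p \in q :: E -> (p.1 s < N)%N /\ (p.2 s < N)%N.
  move=> pE; rewrite /N (perm_big _ (perm_to_rem pE)) /= big_cons.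
  by split; rewrite ltnS -addnA ?leq_addr // addnCA leq_addr.
exists (fun t => (N * w t + (t == s))%N) => p pE; rewrite !wdeg_refine.
have [lt1 lt2] := ltN p pE; move: pE; rewrite inE => pE; apply/eqP => eqp.
have eqs : p.1 s = p.2 s.
  by move: eqp => /(congr1 (modn^~ N)); rewrite ![(N * _)%N]mulnC !modnMDl !modn_small.
have eqw : wdeg w p.1 = wdeg w p.2.
  by move/eqP: eqp; rewrite eqs eqn_add2r eqn_pmul2l // => /eqP.
case/predU1P: pE => [pq|pE]; first by move: neqs; rewrite -pq eqs eqxx.
by move: (neqw p pE); rewrite eqw eqxx.
Qed.

Lemma exists_weight_inj (d : {fset {cmonom S}}) :
  exists w, {in d &, injective (wdeg w)}.
Proof.
pose E := [seq p <- [seq (e, e') | e <- enum_fset d, e' <- enum_fset d] | p.1 != p.2].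
have [p|w neqw] := @exists_separating_weight E.
  by rewrite mem_filter => /andP[].
exists w => e e' ed e'd eqw; apply/eqP/negPn/negP => neqe.
have /neqw/negP[] : (e, e') \in E; last exact/eqP.
by rewrite mem_filter neqe /=; apply/allpairsP; exists (e, e').
Qed.

(** Sends the variable [t] to the power ['X^(w t)] of a single variable, so that a product can be
    tested in the domain [{poly k}]. *)
Definition wspec (w : S -> nat) : {malg k[{cmonom S}]} -> {poly k} :=
  mmap (@polyC k) (cmon_prod (fun t => 'X^(w t))).

HB.instance Definition _ w := GRing.RMorphism.copy (wspec w)
  (mmap (@polyC k) (cmon_prod (fun t => 'X^(w t)))).

(** No two monomials of [d] have the same image, so nothing cancels: the coefficient in degree
    [wdeg w e] is that of [e] in [f]. *)
Lemma wspec_neq0 w f (d : {fset {cmonom S}}) : (msupp f `<=` d)%fset ->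
  {in d &, injective (wdeg w)} -> f != 0 -> wspec w f != 0.
Proof.
move=> le_fd w_inj; rewrite -msupp_eq0 => /fset0Pn[e ef].
apply/eqP => /(congr1 (fun p : {poly k} => p`_(wdeg w e))).
rewrite coef0 /wspec /mmap coef_sum (big_fsetD1 e) //=.
have wE e' : (f@_e')%:P * cmon_prod (fun t => 'X^(w t)) e'
    = f@_e' *: 'X^(wdeg w e').
  rewrite mul_polyC; congr (_ *: _); rewrite /cmon_prod /wdeg.
  by rewrite (big_morph _ (exprD 'X) (expr0 'X)); apply: eq_bigr => t _; rewrite exprM.
rewrite big_seq big1 ?addr0.
  by rewrite wE coefZ coefXn eqxx mulr1 => /eqP; rewrite mcoeff_eq0 ef.
move=> e'; rewrite in_fsetD1 => /andP[neqe e'f]; rewrite wE coefZ coefXn.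
case: eqP => [/w_inj eqe|_]; last exact: mulr0.
by move: neqe; rewrite eqe ?eqxx //; apply: (fsubsetP le_fd).
Qed.

Lemma malg_cmonom_integral f g : f * g = 0 -> (f == 0) || (g == 0).
Proof.
move=> fg0; apply/norP => -[f0 g0].
pose d := (msupp f `|` msupp g)%fset.
have [w w_inj] := exists_weight_inj d.
have /eqP : wspec w (f * g) = 0 by rewrite fg0 raddf0.
by rewrite rmorphM mulf_eq0 !(negPf (wspec_neq0 (d := d) _ w_inj _)) ?fsubsetUl ?fsubsetUr.
Qed.

(** The constant term is [c], and taking constant terms is a ring morphism. *)
Lemma ucm_mul_add_neq0 s (c : k) f : c != 0 -> << ucm s >> * f + c%:MP != 0.
Proof.
move=> c_neq0; pose phi : {rmorphism {malg k[{cmonom S}]} -> k} := mcoeff 1%M.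
have phi_u : phi << ucm s >> = 0 by rewrite [LHS]mcoeffU cm1_eq1.
have phi_c : phi c%:MP = c by exact: malgCK.
by apply: (rmorph_mul_add_neq0 _ phi_u); rewrite phi_c.
Qed.

End CmonomAlgebra.

Section SymTheory.
Variables (k : realType) (S : choiceType).
Local Notation Sym := (Sym k S).
Local Notation hstar := (hstar k S).
Implicit Types (u v : hstar) (f g : Sym) (s t : S).

Lemma Sym_ofE u : Sym_of u = \sum_(s <- msupp u) u@_s *: << ucm s >>.
Proof. by apply: eq_bigr => s _; exact: monalgUZ. Qed.

Lemma Sym_ofEw (d : {fset S}) u : (msupp u `<=` d)%fset ->
  Sym_of u = \sum_(s <- d) u@_s *: << ucm s >>.
Proof.
move=> le_ud; rewrite Sym_ofE (big_fset_incl _ le_ud) //= => s _.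
by move/mcoeff_outdom => ->; rewrite scale0r.
Qed.

Lemma Sym_of_is_linear : linear (@Sym_of k S).
Proof.
move=> c u v; pose d := (msupp u `|` msupp v)%fset.
rewrite (@Sym_ofEw d) ?(@Sym_ofEw d u) ?(@Sym_ofEw d v) ?fsubsetUl ?fsubsetUr //.
  rewrite scaler_sumr -big_split /=; apply: eq_bigr => s _.
  by rewrite mcoeffD mcoeffZ scalerDl scalerA.
apply: fsubset_trans (msuppD_le _ _) _.
by apply: fsetUSS => //; exact: msuppZ_le.
Qed.
HB.instance Definition _ :=
  GRing.isLinear.Build k hstar Sym *:%R (@Sym_of k S) Sym_of_is_linear.

Lemma Sym_of_alpha s : Sym_of (alpha k s) = << ucm s >> :> Sym.
Proof. by rewrite /Sym_of msuppU oner_eq0 big_seq_fset1 mcoeffUU. Qed.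

Lemma Sym_gen_ind (P : Sym -> Prop) :
  (forall f g, P f -> P g -> P (f + g)) -> (forall c, P c%:MP) ->
  (forall s f, P f -> P (Sym_of (alpha k s) * f)) -> forall f, P f.
Proof.
move=> PD PC PV; apply: (@malg_cmonom_ind k S P PD PC) => s f Pf.
by rewrite -Sym_of_alpha; exact: PV.
Qed.

Lemma alpha_neq0 s : Sym_of (alpha k s) != 0.
Proof. by rewrite Sym_of_alpha monalgU_eq0 oner_eq0. Qed.

Lemma alphaM_inj s : injective ( *%R (Sym_of (alpha k s))).
Proof.
move=> f g /eqP; rewrite -subr_eq0 -mulrBr => /eqP /malg_cmonom_integral.
by rewrite (negPf (alpha_neq0 s)) subr_eq0 => /eqP.
Qed.

End SymTheory.

(** * Demazure operators *)

Lemma linear_quotient (R : comNzRingType) (A : comAlgType R) (a f sf df g sg dg : A) c :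
  a * df = f - sf -> a * dg = g - sg ->
  a * (c *: df + dg) = (c *: f + g) - (c *: sf + sg).
Proof.
by move=> ef eg; rewrite mulrDr -scalerAr ef eg scalerBr opprD addrACA.
Qed.

Lemma twisted_leibniz (A : comPzRingType) (a f sf df g sg dg : A) :
  a * df = f - sf -> a * dg = g - sg -> a * (df * g + sf * dg) = f * g - sf * sg.
Proof. by move=> ef eg; rewrite mulrDr mulrA ef mulrCA eg; ring. Qed.

Section Reflections.
Variables (k : realType) (S : choiceType) (m : S -> S -> nat).
Local Notation Sym := (Sym k S).
Local Notation hstar := (hstar k S).
Local Notation alpha := (alpha k).
Local Notation form := (@Defs.form k S m).
Local Notation pairing := (@pairing k S m).
Local Notation srefl := (@srefl k S m).
Local Notation Sym_act := (@Sym_act k S m).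
Implicit Types (u v : hstar) (f g : Sym) (s t : S) (c : k).

Lemma form_alphaEw (d : {fset S}) u s : (msupp u `<=` d)%fset ->
  form u (alpha s) = \sum_(t <- d) u@_t * - cos (pi / (m t s)%:R).
Proof.
move=> le_ud; rewrite /form (big_fset_incl _ le_ud) /=; last first.
  by move=> t _ /mcoeff_outdom ->; rewrite big1 // => s' _; rewrite !mul0r.
apply: eq_bigr => t _.
by rewrite msuppU oner_eq0 big_seq_fset1 mcoeffUU mulr1.
Qed.

Lemma form_alpha t s : form (alpha t) (alpha s) = - cos (pi / (m t s)%:R).
Proof.
by rewrite (form_alphaEw _ msuppU_le) big_seq_fset1 mcoeffUU mul1r.
Qed.

Lemma pairing_lin c u v s :
  pairing (c *: u + v) s = c * pairing u s + pairing v s.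
Proof.
rewrite /pairing mulrA -mulrDl mulrCA -mulrDr; congr (_ * _ / _).
pose d := (msupp u `|` msupp v)%fset.
rewrite (@form_alphaEw d) ?(@form_alphaEw d u) ?(@form_alphaEw d v) ?fsubsetUl ?fsubsetUr //.
  rewrite mulr_sumr -big_split /=; apply: eq_bigr => t _.
  by rewrite mcoeffD mcoeffZ mulrDl mulrA.
apply: fsubset_trans (msuppD_le _ _) _.
by apply: fsetUSS => //; exact: msuppZ_le.
Qed.

Lemma pairing0 s : pairing 0 s = 0.
Proof.
by have := pairing_lin (-1) 0 0 s; rewrite scaler0 addr0 mulN1r addNr.
Qed.

Lemma pairingZ c u s : pairing (c *: u) s = c * pairing u s.
Proof. by rewrite -[c *: u]addr0 pairing_lin pairing0 addr0. Qed.

Lemma pairingD u v s : pairing (u + v) s = pairing u s + pairing v s.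
Proof. by rewrite -[u]scale1r pairing_lin scale1r mul1r. Qed.

Lemma pairingB u v s : pairing (u - v) s = pairing u s - pairing v s.
Proof. by rewrite pairingD -scaleN1r pairingZ mulN1r. Qed.

Lemma srefl_lin c u v s : srefl s (c *: u + v) = c *: srefl s u + srefl s v.
Proof.
rewrite /srefl pairing_lin scalerDl opprD scalerBr scalerA.
by rewrite addrACA.
Qed.

Lemma Sym_act_is_rmorphism s :
  zmod_morphism (Sym_act s) * monoid_morphism (Sym_act s).
Proof.
pose F t := Sym_of (srefl s (alpha t)).
pose phi : {rmorphism Sym -> Sym} := mmap (@malgC {cmonom S} k) (cmon_prod F).
by split; [exact: (raddfB phi)|split; [exact: (rmorph1 phi)|exact: (rmorphM phi)]].
Qed.
HB.instance Definition _ s :=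
  GRing.isZmodMorphism.Build Sym Sym (Sym_act s) (Sym_act_is_rmorphism s).1.
HB.instance Definition _ s :=
  GRing.isMonoidMorphism.Build Sym Sym (Sym_act s) (Sym_act_is_rmorphism s).2.

Lemma Sym_actD s : {morph Sym_act s : f g / f + g}.
Proof. exact: raddfD. Qed.

Lemma Sym_actB s : {morph Sym_act s : f g / f - g}.
Proof. exact: raddfB. Qed.

Lemma Sym_actM s : {morph Sym_act s : f g / f * g}.
Proof. exact: rmorphM. Qed.

Lemma Sym_actC s c : Sym_act s c%:MP = c%:MP.
Proof. by rewrite /Sym_act mmapU mdom1 big_seq_fset0 mulr1. Qed.

Lemma Sym_actZ s c f : Sym_act s (c *: f) = c *: Sym_act s f.
Proof. by rewrite -!mul_malgC Sym_actM Sym_actC. Qed.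

Lemma Sym_act_alpha s t : Sym_act s (Sym_of (alpha t)) = Sym_of (srefl s (alpha t)).
Proof.
rewrite Sym_of_alpha /Sym_act mmapU mdomU big_seq_fset1 cmUU expr1.
exact: mul1r.
Qed.

Lemma hstar_alpha u : u = \sum_(t <- msupp u) u@_t *: alpha t.
Proof.
by rewrite [LHS]monalgE; apply: eq_bigr => t _; exact: monalgUZ.
Qed.

Lemma Sym_of_sum_alpha u : Sym_of u = \sum_(t <- msupp u) u@_t *: Sym_of (alpha t).
Proof.
by rewrite [in LHS](hstar_alpha u) raddf_sum; apply: eq_bigr => t _; exact: linearZ.
Qed.

Lemma Sym_act_of s u : Sym_act s (Sym_of u) = Sym_of (srefl s u).
Proof.
have srefl0 : srefl s 0 = 0 by rewrite /srefl pairing0 scale0r subr0.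
rewrite Sym_of_sum_alpha raddf_sum [in RHS](hstar_alpha u).
have -> (r : seq S) : srefl s (\sum_(t <- r) u@_t *: alpha t)
    = \sum_(t <- r) u@_t *: srefl s (alpha t).
  by elim: r => [|t r IHr]; rewrite ?big_nil // !big_cons srefl_lin IHr.
rewrite raddf_sum; apply: eq_bigr => t _.
by rewrite -[LHS]/(Sym_act s _) Sym_actZ Sym_act_alpha -linearZ.
Qed.

Hypothesis mss : forall s, m s s = 1%N.

Lemma form_alpha_diag s : form (alpha s) (alpha s) = 1.
Proof. by rewrite form_alpha mss divr1 cospi opprK. Qed.

Lemma pairing_alpha t s : pairing (alpha t) s = - (2%:R * cos (pi / (m t s)%:R)).
Proof. by rewrite /pairing form_alpha form_alpha_diag divr1 mulrN. Qed.

Lemma pairing_alpha_diag s : pairing (alpha s) s = 2%:R.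
Proof. by rewrite /pairing form_alpha_diag divr1 mulr1. Qed.

Lemma srefl_alpha_diag s : srefl s (alpha s) = - alpha s.
Proof.
rewrite /srefl pairing_alpha_diag.
by rewrite scaler_nat mulr2n opprD addNKr.
Qed.

Lemma pairing_srefl_diag s u : pairing (srefl s u) s = - pairing u s.
Proof. by rewrite /srefl pairingB pairingZ pairing_alpha_diag; ring. Qed.

Lemma sreflK s : involutive (srefl s).
Proof.
by move=> u; rewrite {1}/srefl pairing_srefl_diag scaleNr opprK /srefl subrK.
Qed.

Lemma Sym_actK s : involutive (Sym_act s).
Proof.
elim/Sym_gen_ind => [f g fK gK|c|t f fK].
- by rewrite !Sym_actD; congr (_ + _).
- by rewrite !Sym_actC.
- rewrite !Sym_actM; congr (_ * _) => //.
  by rewrite !Sym_act_of; congr Sym_of; exact: sreflK.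
Qed.

Lemma alpha_pairing s u :
  Sym_of (alpha s) * (pairing u s)%:MP = Sym_of u - Sym_of (srefl s u).
Proof.
rewrite mulrC mul_malgC -linearZ -[RHS]raddfB; congr Sym_of.
by rewrite /srefl opprB addrC subrK.
Qed.

(** Divisibility by alpha_s passes to products by the twisted Leibniz rule, so it suffices to have
    it on linear forms, where the quotient is the pairing. *)
Lemma dem_exists s f : exists g, Sym_of (alpha s) * g = f - Sym_act s f.
Proof.
elim/Sym_gen_ind: f => [f g [f' ef] [g' eg]|c|t f [f' ef]].
- by exists (f' + g'); rewrite mulrDr ef eg Sym_actD opprD addrACA.
- by exists 0; rewrite Sym_actC mulr0 subrr.
- exists ((pairing (alpha t) s)%:MP * f + Sym_of (srefl s (alpha t)) * f').
  by rewrite Sym_actM Sym_act_of; apply: twisted_leibniz => //; exact: alpha_pairing.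
Qed.

(** The quotient is picked by choice. It is unique by [alphaM_inj], so identities for it can be
    checked after multiplication by alpha_s, see [dem_uniq]. *)
Definition dem s f : Sym := projT1 (cid (dem_exists s f)).

Lemma demE s f : Sym_of (alpha s) * dem s f = f - Sym_act s f.
Proof. exact: projT2 (cid (dem_exists s f)). Qed.

Lemma dem_uniq s f g : Sym_of (alpha s) * g = f - Sym_act s f -> dem s f = g.
Proof. by move=> eg; apply: (@alphaM_inj k S s); rewrite demE eg. Qed.

Lemma dem_is_linear s : linear (dem s).
Proof.
move=> c f g; apply: dem_uniq; rewrite Sym_actD Sym_actZ.
by apply: linear_quotient; exact: demE.
Qed.
HB.instance Definition _ s := GRing.isLinear.Build k Sym Sym *:%R (dem s) (dem_is_linear s).

Lemma demD s : {morph dem s : f g / f + g}.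
Proof. exact: raddfD. Qed.

Lemma demM s f g : dem s (f * g) = dem s f * g + Sym_act s f * dem s g.
Proof. by apply: dem_uniq; rewrite Sym_actM; apply: twisted_leibniz; exact: demE. Qed.

Lemma demC s c : dem s c%:MP = 0.
Proof. by apply: dem_uniq; rewrite mulr0 Sym_actC subrr. Qed.

Lemma dem_of s u : dem s (Sym_of u) = (pairing u s)%:MP.
Proof. by apply: dem_uniq; rewrite Sym_act_of alpha_pairing. Qed.

Lemma dem_ofM s u f :
  dem s (Sym_of u * f) = Sym_of (srefl s u) * dem s f + pairing u s *: f.
Proof. by rewrite demM dem_of Sym_act_of mul_malgC addrC. Qed.

Lemma Sym_act_dem s f : Sym_act s (dem s f) = dem s f.
Proof.
apply: (@alphaM_inj k S s); rewrite demE.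
have -> : Sym_of (alpha s) * Sym_act s (dem s f) = - Sym_act s (Sym_of (alpha s) * dem s f).
  by rewrite Sym_actM Sym_act_of srefl_alpha_diag raddfN mulNr opprK.
by rewrite demE Sym_actB Sym_actK opprB.
Qed.

Lemma demK s f : dem s (dem s f) = 0.
Proof. by apply: dem_uniq; rewrite Sym_act_dem mulr0 subrr. Qed.

Lemma dem_act s f : dem s (Sym_act s f) = - dem s f.
Proof. by apply: dem_uniq; rewrite mulrN demE Sym_actK opprB. Qed.

End Reflections.

(** * Alternating words in two Demazure operators *)

(* The alternating word of length [n] whose rightmost letter is [b]. *)
Fixpoint alt_word (A : Type) (d : bool -> A -> A) b n (f : A) : A :=
  if n is n'.+1 then alt_word d (~~ b) n' (d b f) else f.

Lemma alt_word_recl (A : Type) (d : bool -> A -> A) b n f :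
  alt_word d b n.+1 f = d (b (+) odd n) (alt_word d b n f).
Proof.
elim: n b f => [|n IHn] b f; first by rewrite addbF.
by rewrite -[LHS]/(alt_word d (~~ b) n.+1 (d b f)) IHn /= addNb addbN.
Qed.

Section DihedralWords.
Variables (k : fieldType) (A : comAlgType k) (V : lmodType k) (of_ : V -> A).
Variables (x : bool -> V -> k) (a : bool -> V) (d : bool -> A -> A) (c : k).
Implicit Types (b : bool) (n : nat) (l : V) (f g : A).

Definition refl b l := l - x b l *: a b.

(** What words in two Demazure operators see of the root system: [x b] is the pairing with the
    coroot of [a b], and [c] stands for 2 cos (pi / m). *)
Record demazure_pair : Prop := {
  dp_xD : forall b, {morph x b : l l' / l + l'};
  dp_xZ : forall b e l, x b (e *: l) = e * x b l;
  dp_diag : forall b, x b (a b) = 2%:R;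
  dp_offdiag : forall b, x b (a (~~ b)) = - c;
  dp_dD : forall b, {morph d b : f g / f + g};
  dp_dZ : forall b e f, d b (e *: f) = e *: d b f;
  dp_dM : forall b l f, d b (of_ l * f) = of_ (refl b l) * d b f + x b l *: f;
  dp_dK : forall b f, d b (d b f) = 0;
  dp_d1 : forall b, d b 1 = 0;
  dp_ind : forall P : A -> Prop, (forall f g, P f -> P g -> P (f + g)) ->
    (forall e, P (e *: 1)) -> (forall l f, P f -> P (of_ l * f)) -> forall f, P f
}.

Local Notation alt := (alt_word d).

Fixpoint alt_refl b n l : V :=
  if n is n'.+1 then alt_refl (~~ b) n' (refl b l) else l.

(* [cheb n] is [sin (n t) / sin t] when [c = 2 cos t], see [cheb_sin]. *)
Fixpoint cheb n : k :=
  match n with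
  | 0 => 0
  | n'.+1 => if n' is n''.+1 then c * cheb n' - cheb n'' else 1
  end.

Lemma chebSS n : cheb n.+2 = c * cheb n.+1 - cheb n.
Proof. by []. Qed.

(** These partial sums are the coefficients of the two roots in an alternating product of
    reflections, see [alt_reflE]. *)
Definition cheb_odd n := \sum_(i < n.+1 | odd i) cheb i.
Definition cheb_even n := \sum_(i < n.+1 | ~~ odd i) cheb i.

Lemma cheb_oddS n : cheb_odd n.+1 = cheb_odd n + (if odd n then 0 else cheb n.+1).
Proof. by rewrite /cheb_odd big_mkcond big_ord_recr /= -big_mkcond /=; case: (odd n). Qed.

Lemma cheb_evenS n : cheb_even n.+1 = cheb_even n + (if odd n then cheb n.+1 else 0).
Proof. by rewrite /cheb_even big_mkcond big_ord_recr /= -big_mkcond /=; case: (odd n). Qed.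

Lemma cheb_odd0 : cheb_odd 0 = 0.
Proof. by rewrite /cheb_odd big_mkcond big_ord1. Qed.

Lemma cheb_even0 : cheb_even 0 = 0.
Proof. by rewrite /cheb_even big_mkcond big_ord1. Qed.

Lemma cheb_sumSS n : cheb_odd n.+2 = 1 + c * cheb_even n.+1 - cheb_odd n /\
  cheb_even n.+2 = c * cheb_odd n.+1 - cheb_even n.
Proof.
elim: n => [|n [IHo IHe]].
  by rewrite !(cheb_oddS, cheb_evenS) cheb_odd0 cheb_even0 /=; split; ring.
split.
  rewrite (cheb_evenS n.+1) (cheb_oddS n) (cheb_oddS n.+2) IHo chebSS /=.
  by case: (odd n) => /=; ring.
rewrite (cheb_oddS n.+1) (cheb_evenS n) (cheb_evenS n.+2) IHe chebSS /=.
by case: (odd n) => /=; ring.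
Qed.

Hypothesis dp : demazure_pair.

Lemma x_offdiagN b : x (~~ b) (a b) = - c.
Proof. by have := dp_offdiag dp (~~ b); rewrite negbK. Qed.

Lemma x_refl b l : x b (refl b l) = - x b l.
Proof.
by rewrite /refl -scaleNr (dp_xD dp) (dp_xZ dp) (dp_diag dp); ring.
Qed.

Lemma x_reflN b l : x (~~ b) (refl b l) = x (~~ b) l + c * x b l.
Proof.
rewrite /refl -scaleNr (dp_xD dp) (dp_xZ dp).
by rewrite x_offdiagN; ring.
Qed.

Lemma alt_reflE b n l : alt_refl b n.+1 l =
  l - (cheb_odd n.+1 * x b l + cheb_even n * x (~~ b) l) *: a b
    - (cheb_even n.+1 * x b l + cheb_odd n * x (~~ b) l) *: a (~~ b).
Proof.
elim: n b l => [|n IHn] b l.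
  rewrite /= !(cheb_oddS, cheb_evenS) cheb_odd0 cheb_even0 /= !mul0r !addr0 add0r.
  by rewrite mul1r mul0r scale0r subr0.
rewrite [LHS]IHn negbK x_refl x_reflN {1}/refl.
have [-> ->] := cheb_sumSS n; rewrite -!addrA; congr (_ + _).
rewrite -!scaleNr [in LHS]addrC -!addrA -scalerDl addrC.
by congr (_ *: _ + _ *: _); ring.
Qed.

(** If [cheb n.+1] vanishes, the partial sums at [n] and [n.+1] agree and [alt_reflE] becomes
    symmetric in the two letters. This is the braid relation for the reflections. *)
Lemma alt_refl_sym n b l : cheb n.+1 = 0 ->
  alt_refl b n.+1 l = alt_refl (~~ b) n.+1 l.
Proof.
move=> qn; rewrite !alt_reflE negbK cheb_oddS cheb_evenS qn !if_same !addr0.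
rewrite -!addrA; congr (_ + _); rewrite addrC.
by congr (- (_ *: _) - _ *: _); rewrite addrC.
Qed.

Lemma altD n b : {morph alt b n : f g / f + g}.
Proof. by elim: n b => [//|n IHn] b f g /=; rewrite (dp_dD dp) IHn. Qed.

Lemma altZ n b e f : alt b n (e *: f) = e *: alt b n f.
Proof. by elim: n b f => [//|n IHn] b f /=; rewrite (dp_dZ dp) IHn. Qed.

Lemma alt0 n b : alt b n 0 = 0.
Proof. by have := altZ n b 0 0; rewrite !scale0r. Qed.

Lemma alt_dK n b f : alt b n.+1 (d b f) = 0.
Proof. by rewrite /= (dp_dK dp) alt0. Qed.

(** Moving [of_ l] to the left through the word deletes one letter at a time. Deleting an inner
    letter leaves two equal neighbours, which vanish by [dp_dK]; the second term deletes the
    leftmost letter and the third the rightmost one. For [n = 0] these are the same letter, counted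
    once. *)
Lemma altMS n b l f : alt b n.+1 (of_ l * f) =
  of_ (alt_refl b n.+1 l) * alt b n.+1 f
  + (cheb n.+1 * x b l + cheb n * x (~~ b) l) *: alt b n f
  + (if n is 0 then 0 else x b l *: alt (~~ b) n f).
Proof.
elim: n b l f => [|n IHn] b l f.
  by rewrite /= (dp_dM dp) mul1r mul0r !addr0.
rewrite -[LHS]/(alt (~~ b) n.+1 (d b (of_ l * f))) (dp_dM dp) altD altZ.
rewrite IHn negbK x_refl x_reflN; congr (_ + _); rewrite -addrA; congr (_ + _).
have -> : (if n is 0 then 0 else (x (~~ b) l + c * x b l) *: alt b n (d b f)) = 0.
  by case: n {IHn} => [//|n]; rewrite alt_dK scaler0.
by rewrite addr0 chebSS; congr (_ *: _); ring.
Qed.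

Lemma alt1S n b : alt b n.+1 1 = 0.
Proof. by rewrite /= (dp_d1 dp) alt0. Qed.

(* The operator [alt true n.+1 - alt false n.+1] is killed by 1 and twisted-commutes
   with multiplication by [of_ l], because only the deletions of the first or
   of the last letter survive in the commutation formula [altMS]. *)
Lemma alt_braid n f : cheb n.+1 = 0 -> cheb n = 1 ->
  alt true n.+1 f = alt false n.+1 f.
Proof.
move=> q0 q1; elim/(dp_ind dp): f => [f g ef eg|e|l f ef].
- by rewrite !altD ef eg.
- by rewrite !altZ !alt1S.
rewrite !altMS ef q0 q1 !mul0r !add0r !mul1r (alt_refl_sym _ _ q0) -!addrA.
congr (_ + _); case: n q0 q1 {ef} => [_ /eqP|n _ _]; last exact: addrC.
by rewrite eq_sym oner_eq0.
Qed.

(** Each letter lowers the polynomial degree by one. *)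
Lemma alt_exp_lt n b l j : (j < n)%N -> alt b n (of_ l ^+ j) = 0.
Proof.
elim: j n b => [|j IHj] [//|n] b ltjn; first exact: alt1S.
rewrite exprS altMS !IHj ?(ltnW ltjn) // mulr0 scaler0 !add0r.
by case: n ltjn => // n _; rewrite scaler0.
Qed.

(** A multiple of the fundamental weight in the span of the two roots: it pairs to 0 with the other
    coroot. *)
Definition dual_vec b := 2%:R *: a b + c *: a (~~ b).

Lemma x_dual b : x b (dual_vec b) = 4%:R - c ^+ 2.
Proof.
by rewrite (dp_xD dp) !(dp_xZ dp) (dp_diag dp) (dp_offdiag dp); ring.
Qed.

Lemma x_dualN b : x (~~ b) (dual_vec b) = 0.
Proof.
by rewrite (dp_xD dp) !(dp_xZ dp) (dp_diag dp) x_offdiagN; ring.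
Qed.

Lemma d_dual_exp b j : d (~~ b) (of_ (dual_vec b) ^+ j) = 0.
Proof.
elim: j => [|j IHj]; first exact: (dp_d1 dp).
by rewrite exprS (dp_dM dp) IHj x_dualN mulr0 scale0r addr0.
Qed.

Lemma alt_dual_expN b n j : alt (~~ b) n.+1 (of_ (dual_vec b) ^+ j) = 0.
Proof. by rewrite /= d_dual_exp alt0. Qed.

(** In [altMS] the first term vanishes by degree, and the last because its rightmost letter kills
    powers of [dual_vec b]. Each step therefore contributes one Chebyshev value times
    [4 - c ^+ 2]. *)
Lemma alt_dual_exp b n : alt b n (of_ (dual_vec b) ^+ n) =
  (\prod_(i < n) (cheb i.+1 * (4%:R - c ^+ 2))) *: 1.
Proof.
elim: n => [|n IHn]; first by rewrite big_ord0 scale1r.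
rewrite exprS altMS alt_exp_lt // IHn x_dual x_dualN !mulr0 add0r addr0.
rewrite big_ord_recr /= scalerA mulrC.
by case: n {IHn} => [|n]; rewrite ?addr0 // alt_dual_expN scaler0 addr0.
Qed.

Hypothesis c_nondeg : 4%:R - c ^+ 2 != 0.
Hypothesis char2 : 2%:R != 0 :> k.

(* For [j < 2 m] this lists the [2 m] elements of a dihedral group by length, the
   two alternating words of length [m] being counted once. *)
Definition alt_nth j := alt (odd j) (uphalf j).

(** The words are triangular against test polynomials: word [j] sends [p j] to a nonzero constant
    and [p i] to 0 for [i < j]. Evaluating the relation at [p j] isolates [e j] once the earlier
    coefficients are known to vanish. *)
Lemma alt_nth_indep n (e : nat -> A) : cheb n.+1 = 0 -> cheb n = 1 ->
  (forall i, (0 < i <= n)%N -> cheb i != 0) ->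
  (forall f, \sum_(j < n.+1.*2) e j * alt_nth j f = 0) ->
  forall j, (j < n.+1.*2)%N -> e j = 0.
Proof.
move=> q0 q1 qneq0 sum0.
(* The longest word has index [n.*2.+1] and length [n.+1]. It kills the power [n.+1] of
   [dual_vec true], because [cheb n.+1 = 0], so one factor is replaced by the other root. *)
pose p j := if j == n.*2.+1 then of_ (a false) * of_ (dual_vec true) ^+ n
            else of_ (dual_vec (odd j)) ^+ uphalf j.
have prod_neq0 i : (i <= n)%N ->
    \prod_(j < i) (cheb j.+1 * (4%:R - c ^+ 2)) != 0.
  move=> le_in; apply/prodf_neq0 => j _; rewrite mulf_neq0 // qneq0 //=.
  exact: leq_trans (ltn_ord j) le_in.
have n_gt0 : (0 < n)%N.
  by case: n q1 {q0 qneq0 sum0 p prod_neq0} => // /eqP; rewrite eq_sym oner_eq0.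
have p_diag j : (j < n.+1.*2)%N -> exists2 v, v != 0 & alt_nth j (p j) = v *: 1.
  rewrite /p /alt_nth; case: eqP => [-> _|neqj ltj]; last first.
    rewrite alt_dual_exp; eexists; last reflexivity.
    by apply: prod_neq0; lia.
  have -> : odd n.*2.+1 = true by lia.
  have -> : uphalf n.*2.+1 = n.+1 by lia.
  rewrite altMS alt_exp_lt // mulr0 add0r.
  rewrite q0 q1 mul0r add0r mul1r (dp_diag dp) alt_dual_exp scalerA.
  case: n n_gt0 {q0 q1 qneq0 sum0 p} prod_neq0 => // n _ prod_neq0.
  rewrite (alt_dual_expN true) scaler0 addr0; eexists; last reflexivity.
  by rewrite mulf_neq0 ?prod_neq0.
have p_gt i j : (i < j < n.+1.*2)%N -> alt_nth j (p i) = 0.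
  move=> /andP[ltij ltj]; rewrite /p /alt_nth.
  have -> : (i == n.*2.+1) = false by apply/eqP; lia.
  (* A longer word kills [p i] by degree; among words of equal length, the one with the other
     rightmost letter kills a power of the dual vector. *)
  have [ltu|leu] := ltnP (uphalf i) (uphalf j); first exact: alt_exp_lt.
  have -> : odd j = ~~ odd i by lia.
  by have -> : uphalf j = j.-1./2.+1 by [lia]; exact: alt_dual_expN.
elim/ltn_ind => j IHj ltj.
have [v v_neq0 pj] := p_diag j ltj.
have := sum0 (p j); rewrite (bigD1 (Ordinal ltj)) //= pj big1 => [|i neqij].
  by rewrite addr0 -scalerAr mulr1 => /eqP; rewrite scaler_eq0 (negPf v_neq0) => /eqP.
have [ltij|ltji|eqij] := ltngtP i j; first by rewrite IHj ?mul0r.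
  by rewrite p_gt ?mulr0 ?ltji ?ltn_ord.
by move: neqij; rewrite -val_eqE /= eqij eqxx.
Qed.

End DihedralWords.

(** * Chebyshev values at the angle [pi / m] *)

Section Chebyshev.
Variable k : realType.
Implicit Type t : k.

Lemma cheb_sin t n : cheb (2%:R * cos t) n * sin t = sin (n%:R * t).
Proof.
have [//] : cheb (2%:R * cos t) n * sin t = sin (n%:R * t) /\
    cheb (2%:R * cos t) n.+1 * sin t = sin (n.+1%:R * t).
elim: n => [|n [IHn IHn1]]; first by rewrite !mul0r sin0 !mul1r.
split=> //; rewrite chebSS mulrBl -mulrA IHn IHn1.
have -> : n.+2%:R * t = n.+1%:R * t + t by rewrite -addn1 natrD mulrDl mul1r.
have -> : n%:R * t = n.+1%:R * t - t by rewrite -addn1 natrD mulrDl mul1r addrK.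
by rewrite sinB sinD; ring.
Qed.

Variable m : nat.
Hypothesis m_gt1 : (1 < m)%N.
Let t := pi / m%:R : k.

Lemma sin_frac_gt0 n : (0 < n < m)%N -> 0 < sin (n%:R * t).
Proof.
move=> /andP[n_gt0 ltnm]; have m_gt0 : 0 < m%:R :> k by rewrite ltr0n (ltn_trans _ ltnm).
apply: sin_gt0_pi; rewrite /t mulrCA; apply/andP; split.
  by rewrite mulr_gt0 ?pi_gt0 // divr_gt0 // ltr0n.
by rewrite gtr_pMr ?pi_gt0 // ltr_pdivrMr // mul1r ltr_nat.
Qed.

Lemma sin_frac1_neq0 : sin t != 0.
Proof. by have := @sin_frac_gt0 1 m_gt1; rewrite mul1r lt0r => /andP[]. Qed.

Lemma m_frac : m%:R * t = pi.
Proof. by rewrite /t mulrCA divff ?mulr1 // pnatr_eq0; lia. Qed.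

Lemma cheb_frac_neq0 n : (0 < n < m)%N -> cheb (2%:R * cos t) n != 0.
Proof.
move=> /sin_frac_gt0; rewrite -cheb_sin => /lt0r_neq0.
by apply: contraNneq => ->; rewrite mul0r.
Qed.

Lemma cheb_frac_m : cheb (2%:R * cos t) m = 0.
Proof.
by apply: (mulIf sin_frac1_neq0); rewrite cheb_sin m_frac sinpi mul0r.
Qed.

Lemma cheb_frac_pred_m : cheb (2%:R * cos t) m.-1 = 1.
Proof.
apply: (mulIf sin_frac1_neq0); rewrite cheb_sin mul1r.
have -> : m.-1%:R * t = pi - t.
  by rewrite -m_frac -[in m%:R](ltn_predK m_gt1) -natr1 mulrDl mul1r addrK.
by rewrite sinB sinpi cospi; ring.
Qed.

Lemma four_sub_cos2 : 4%:R - (2%:R * cos t) ^+ 2 != 0.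
Proof.
have -> : 4%:R - (2%:R * cos t) ^+ 2 = (2%:R * sin t) ^+ 2.
  by rewrite !exprMn sin2cos2; ring.
by rewrite expf_neq0 // mulf_neq0 ?pnatr_eq0 // sin_frac1_neq0.
Qed.

End Chebyshev.

(** * The Coxeter matrix *)

Section CoxeterNumbers.
Variables (W : groupType) (S : choiceType) (sigma : S -> W) (m : S -> S -> nat).
Hypothesis cox : coxeter_system sigma m.

Lemma coxeter_diag s : m s s = 1%N.
Proof.
have [_ ord inv _] := cox; apply/eqP; rewrite -dvdn1; apply/ord.
by rewrite expg1; exact: inv.
Qed.

Lemma coxeter_involutive s : ((sigma s)^-1 = sigma s)%g.
Proof.
have [_ _ inv _] := cox; apply: (mulgI (sigma s)).
by rewrite mulgV; symmetry; exact: inv.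
Qed.

(** The element ts is the inverse of st, so each order divides the other. *)
Lemma coxeter_sym s t : m s t = m t s.
Proof.
have [_ ord _ _] := cox.
have dvd s' t' : (m s' t' %| m t' s')%N.
  apply/ord; apply: invg_inj; rewrite -expVgn invgM !coxeter_involutive invg1.
  by apply/ord.
by apply/eqP; rewrite eqn_dvd !dvd.
Qed.

Lemma coxeter_neq1 s t : s <> t -> m s t != 1%N.
Proof.
have [inj ord _ _] := cox; move=> neq; apply/eqP => mst; apply: neq; apply: inj.
have /ord : (m s t %| 1)%N by rewrite mst.
rewrite expg1 => st; apply: (mulIg (sigma t)); rewrite st.
by symmetry; have [_ _ inv _] := cox; exact: inv.
Qed.

End CoxeterNumbers.

(** * The braid relation for Demazure operators and the polynomial representation *)

Section DemazureBraid.
Variables (k : realType) (S : choiceType) (m : S -> S -> nat).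
Hypothesis mss : forall s, m s s = 1%N.
Hypothesis msym : forall s t, m s t = m t s.
Local Notation Sym := (Sym k S).
Local Notation dem := (@dem k S m).

Section Pair.
Variables s t : S.
Let l (b : bool) := if b then s else t.

Lemma dem_pair : demazure_pair (@Sym_of k S)
  (fun b u => pairing m u (l b)) (fun b => alpha k (l b)) (fun b => dem (l b))
  (2%:R * cos (pi / (m s t)%:R)).
Proof.
split.
- by move=> b u v; exact: pairingD.
- by move=> b c u; exact: pairingZ.
- by move=> b; exact: pairing_alpha_diag.
- by move=> [] /=; rewrite pairing_alpha // msym.
- by move=> b f g; exact: raddfD.
- by move=> b c f; exact: linearZ.
- by move=> b u f; exact: dem_ofM.
- by move=> b f; exact: demK.
- by move=> b; exact: (demC m (l b) 1).
- move=> P PD PC PV; apply: Sym_gen_ind => // [c|s' f]; last exact: PV.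
  by rewrite -[c%:MP]mulr1 mul_malgC.
Qed.

Hypothesis m_gt1 : (1 < m s t)%N.

Lemma dem_braid b f :
  alt_word (fun b => dem (l b)) b (m s t) f = alt_word (fun b => dem (l b)) (~~ b) (m s t) f.
Proof.
rewrite -(ltn_predK m_gt1).
have cm : cheb (2%:R * cos (pi / (m s t)%:R) : k) (m s t).-1.+1 = 0.
  by rewrite (ltn_predK m_gt1) cheb_frac_m.
have br := alt_braid dem_pair f cm (cheb_frac_pred_m k m_gt1).
by case: b => /=; [exact: br|symmetry; exact: br].
Qed.

End Pair.

Section Rep.
Hypothesis mneq1 : forall s t, s <> t -> m s t != 1%N.

Definition dem_op (g : nilH_gen k S) : Sym -> Sym :=
  match g with GenV u => *%R (Sym_of u) | GenD s => dem s end.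

(** A braid word is indexed by its leftmost letter and [alt_word] by its rightmost one; the parity
    of [n] converts between the two. *)
Lemma term_op_braid (T : zmodType) (C : k -> T -> T) (G : nilH_gen k S -> T -> T)
    (s t : S) n b v : (forall v, C 1 v = v) ->
  term_op C G (if b then braid_word k n s t else braid_word k n t s) v =
  alt_word (fun b => G (GenD k (if b then s else t))) (b (+) ~~ odd n) n v.
Proof.
move=> C1; elim: n b => [|n IHn] b; first by case: b => /=; rewrite C1.
have -> : (if b then braid_word k n.+1 s t else braid_word k n.+1 t s) =
    TMul (TVar (GenD k (if b then s else t)))
      (if ~~ b then braid_word k n s t else braid_word k n t s) by case: b.
rewrite -[LHS]/(G (GenD k (if b then s else t)) (term_op C G
  (if ~~ b then braid_word k n s t else braid_word k n t s) v)) IHn alt_word_recl.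
by case: b => /=; case: (odd n) => /=.
Qed.

Lemma dem_op_module : term_module (fun c : k => *:%R c) dem_op (@nilH_rel k S m).
Proof.
split.
- by case=> [u|s] f g; [exact: mulrDr|exact: raddfD].
- by move=> c f g; exact: scalerDr.
- by move=> c c' f; exact: scalerDl.
- by move=> c c' f; rewrite scalerA.
- by move=> f; exact: scale1r.
- by move=> c [u|s] f /=; [rewrite scalerAr|rewrite linearZ].
- move=> a b; case=> {a b} /=.
  + move=> c u v f; rewrite scalerAl -mulrDl; congr (_ * _); exact: linearP.
  + by move=> u v f; exact: mulrCA.
  + by move=> s u f; exact: dem_ofM.
  + by move=> s f; rewrite demK //; symmetry; exact: scale0r.
  + move=> s t neq m_gt0 f.
    have m_gt1 : (1 < m s t)%N by have := mneq1 neq; lia.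
    have bw b := @term_op_braid Sym (fun c => *:%R c) dem_op s t (m s t) b f (@scale1r _ _).
    transitivity (alt_word (fun b => dem (if b then s else t)) (true (+) ~~ odd (m s t)) (m s t) f).
      exact: (bw true).
    by rewrite (dem_braid m_gt1) addTb !negbK; symmetry; exact: (bw false).
Qed.

Definition rho : nilH k m -> Sym -> Sym :=
  pres_act (fun c : k => *:%R c) dem_op (rel := @nilH_rel k S m).

End Rep.
End DemazureBraid.

(** * The tensor product of two modules over the nil Hecke algebra *)

Section TensorExt.
Variables (R : Type) (U V Z : zmodType).
Variables (actU : R -> {additive U -> U}) (actV : R -> {additive V -> V}).
Local Notation T := (tensor actU actV).

Lemma morph_add0 (X : zmodType) (F : X -> Z) : {morph F : x y / x + y} -> F 0 = 0.
Proof. by move=> FD; apply: (@addrI _ (F 0)); rewrite -FD !addr0. Qed.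

Lemma morph_sum (X : zmodType) (F : X -> Z) (I : Type) (r : seq I) (P : pred I)
  (G : I -> X) : {morph F : x y / x + y} ->
  F (\sum_(i <- r | P i) G i) = \sum_(i <- r | P i) F (G i).
Proof. by move=> FD; apply: (big_morph F FD (morph_add0 FD)). Qed.

Lemma tensor_ext (F G : T -> Z) :
  {morph F : x y / x + y} -> {morph G : x y / x + y} ->
  (forall u v, F (pure actU actV u v) = G (pure actU actV u v)) -> F =1 G.
Proof.
move=> FD GD FG; elim/tens_ind => r.
by rewrite tens_pi_sum !morph_sum //; apply: eq_bigr => p _; exact: FG.
Qed.

Local Notation "u ## v" := (pure actU actV u v) (at level 35).

Lemma eq_tlift (f g : U -> V -> Z) (x : T) : f =2 g -> tlift f x = tlift g x.
Proof. by move=> fg; apply: eq_bigr => p _; exact: fg. Qed.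

(** Writes an additive map as a lift, so that it can be compared with another lift by [eq_tlift]
    without a balancedness proof for the latter. *)
Lemma tlift_additive (F : T -> Z) (x : T) : {morph F : x y / x + y} ->
  tlift (fun u v => F (u ## v)) x = F x.
Proof. by move=> FD; rewrite -[in RHS](tens_reprK x) tens_pi_sum morph_sum. Qed.

End TensorExt.

Section PureTensors.
Variables (R : Type) (U V : zmodType).
Variables (actU : R -> {additive U -> U}) (actV : R -> {additive V -> V}).
Local Notation "u ## v" := (pure actU actV u v) (at level 35).

Lemma pureDl u u' v : (u + u') ## v = u ## v + u' ## v.
Proof. by have [h _ _] := pure_balanced actU actV; exact: h. Qed.

Lemma pureDr u v v' : u ## (v + v') = u ## v + u ## v'.
Proof. by have [_ h _] := pure_balanced actU actV; exact: h. Qed.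

Lemma pure_bal r u v : (actU r u) ## v = u ## (actV r v).
Proof. by have [_ _ h] := pure_balanced actU actV; exact: h. Qed.

Lemma pure0l v : 0 ## v = 0.
Proof. by apply: (@morph_add0 _ _ (fun u => u ## v)) => u u'; exact: pureDl. Qed.

Lemma pure0r u : u ## 0 = 0.
Proof. by apply: (@morph_add0 _ _ (fun v => u ## v)) => v v'; exact: pureDr. Qed.

Lemma pureNl u v : (- u) ## v = - (u ## v).
Proof. by apply/eqP; rewrite -addr_eq0 -pureDl addNr pure0l. Qed.

Lemma pureNr u v : u ## (- v) = - (u ## v).
Proof. by apply/eqP; rewrite -addr_eq0 -pureDr addNr pure0r. Qed.

Lemma pureBl u u' v : (u - u') ## v = u ## v - u' ## v.
Proof. by rewrite pureDl pureNl. Qed.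

Lemma pureBr u v v' : u ## (v - v') = u ## v - u ## v'.
Proof. by rewrite pureDr pureNr. Qed.

Lemma left_balanced (phi : U -> U) : {morph phi : u u' / u + u'} ->
  (forall r u, phi (actU r u) = actU r (phi u)) ->
  balanced actU actV (fun u v => phi u ## v).
Proof.
move=> phiD phiC; split=> [v u u'|u v v'|r u v].
- by rewrite phiD pureDl.
- by rewrite pureDr.
- by rewrite phiC pure_bal.
Qed.

End PureTensors.

(* A left module over the nil Hecke algebra, except for the nilpotency and the
   braid relations. *)
Record skew_module (R : comPzRingType) (S : Type) (act dem : S -> R -> R)
    (U : zmodType) (aU : R -> {additive U -> U}) (dU : S -> U -> U) : Prop := {
  sm_add : forall r r' u, aU (r + r') u = aU r u + aU r' u;
  sm_mul : forall r r' u, aU (r * r') u = aU r (aU r' u);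
  sm_dD : forall s, {morph dU s : u v / u + v};
  sm_cross : forall s r u,
    dU s (aU r u) = aU (act s r) (dU s u) + aU (dem s r) u
}.

Section SkewTensor.
Variables (R : comPzRingType) (S : Type) (act dem : S -> R -> R) (al : S -> R).
Hypothesis demE : forall s r, al s * dem s r = r - act s r.
Variables (U V : zmodType) (aU : R -> {additive U -> U}) (aV : R -> {additive V -> V}).
Variables (dU : S -> U -> U) (dV : S -> V -> V).
Hypotheses (smU : skew_module act dem aU dU) (smV : skew_module act dem aV dV).
Local Notation "u ## v" := (pure aU aV u v) (at level 35).

(** Since s = 1 - alpha D, the second summand is su (x) Dv. Two modules are allowed because the
    construction also serves for (H (x) H) (x) H. *)
Definition skew_pure s u v := dU s u ## v + (u - aU (al s) (dU s u)) ## dV s v.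

Lemma sm_sub r r' u : aU (r - r') u = aU r u - aU r' u.
Proof. by apply: (@addIr _ (aU r' u)); rewrite -(sm_add smU) !subrK. Qed.

(** The formula respects the tensor product over R because s(ru) = s(r) su and D(ru) = r Du + dem(r)
    su; the remaining terms recombine into D(rv). *)
Lemma skew_balanced s : balanced aU aV (skew_pure s).
Proof.
rewrite /skew_pure; split=> [v u u'|u v v'|r u v].
- by rewrite (sm_dD smU) raddfD opprD addrACA !pureDl addrACA.
- by rewrite (sm_dD smV) !pureDr addrACA.
rewrite (sm_cross smU) (sm_cross smV) raddfD -(sm_mul smU) -(sm_mul smU) demE.
have -> : aU r u - (aU (al s * act s r) (dU s u) + aU (r - act s r) u) =
    aU (act s r) (u - aU (al s) (dU s u)).
  rewrite sm_sub raddfB -(sm_mul smU) [al s * _]mulrC opprD opprB.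
  by rewrite addrCA [X in _ + X]addrCA subrr addr0 addrC.
have -> : aU (act s r) (dU s u) + aU (dem s r) u =
    aU r (dU s u) + aU (dem s r) (u - aU (al s) (dU s u)).
  rewrite raddfB -(sm_mul smU) [dem s r * _]mulrC demE sm_sub opprB.
  by rewrite [RHS]addrCA [LHS]addrC; congr (_ + _); rewrite addrC subrK.
move: (u - _) => u'; rewrite pureDl !pure_bal pureDr -addrA.
by congr (_ + _); exact: addrC.
Qed.

Definition skew_op s : tensor aU aV -> tensor aU aV := tlift (skew_pure s).

Lemma skew_opE s u v :
  skew_op s (u ## v) = dU s u ## v + (u - aU (al s) (dU s u)) ## dV s v.
Proof. by rewrite /skew_op tlift_pure //; exact: skew_balanced. Qed.

Lemma skew_opD s : {morph skew_op s : x y / x + y}.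
Proof. exact: tlift_add (skew_balanced s). Qed.

End SkewTensor.


(** * The operators D on H (x) H and their braid relation *)

Section CrossRelations.
Variables (R : comPzRingType) (H : pzRingType) (iota : {rmorphism R -> H}).
Variables (S : Type) (act dem : S -> R -> R) (al : S -> R) (D : S -> H).

Record nil_cross : Prop := {
  nc_cross : forall s r, D s * iota r = iota (act s r) * D s + iota (dem s r);
  nc_sq : forall s, D s * D s = 0;
  nc_demE : forall s r, al s * dem s r = r - act s r;
  nc_dem_al : forall s, dem s (al s) = 2%:R
}.

Hypothesis nc : nil_cross.

Definition hw s : H := 1 - iota (al s) * D s.

Lemma act_al s : act s (al s) = - al s.
Proof.
have := nc_demE nc s (al s); rewrite (nc_dem_al nc) mulr_natr mulr2n => /eqP.
by rewrite eq_sym subr_eq addrC -subr_eq opprD addNKr => /eqP ->.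
Qed.

Lemma D_al s : D s * iota (al s) = 2%:R - iota (al s) * D s.
Proof.
by rewrite (nc_cross nc) act_al (nc_dem_al nc) rmorphN rmorph_nat mulNr addrC.
Qed.

Lemma hw_iota s r : hw s * iota r = iota (act s r) * hw s.
Proof.
rewrite /hw mulrBl mul1r -mulrA (nc_cross nc) mulrDr -[X in _ - (_ + X)]rmorphM.
rewrite (nc_demE nc) rmorphB opprD opprB addrCA [X in _ + X]addrCA subrr addr0.
by rewrite addrC mulrBr mulr1 !mulrA -!rmorphM [al s * _]mulrC.
Qed.

Lemma D_al_D s : D s * iota (al s) * D s = 2%:R * D s.
Proof. by rewrite D_al mulrBl -mulrA (nc_sq nc) mulr0 subr0. Qed.

Lemma D_hw s : D s * hw s = - D s.
Proof. by rewrite /hw mulrBr mulr1 mulrA D_al_D mulr_natl mulr2n opprD addNKr. Qed.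

Lemma hw_D s : hw s * D s = D s.
Proof. by rewrite /hw mulrBl mul1r -mulrA (nc_sq nc) mulr0 subr0. Qed.

Lemma hwK s : hw s * hw s = 1.
Proof.
by rewrite {1}/hw mulrBl mul1r -mulrA D_hw mulrN opprK /hw subrK.
Qed.

Local Notation T := (HoH iota).
Local Notation lactT := (@lactT R H iota).
Local Notation "a # b" := (otens iota a b) (at level 35).

Lemma otensDl a a' b : (a + a') # b = a # b + a' # b.
Proof. exact: pureDl. Qed.

Lemma otensDr a b b' : a # (b + b') = a # b + a # b'.
Proof. exact: pureDr. Qed.

Lemma otens_iota r a b : (iota r * a) # b = a # (iota r * b).
Proof. exact: (pure_bal (fun r => lact iota r) (fun r => lact iota r)). Qed.

Lemma otens0l b : 0 # b = 0.
Proof. exact: pure0l. Qed.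

Lemma otens0r a : a # 0 = 0.
Proof. exact: pure0r. Qed.

Lemma otensNl a b : (- a) # b = - (a # b).
Proof. exact: pureNl. Qed.

Lemma otensNr a b : a # (- b) = - (a # b).
Proof. exact: pureNr. Qed.

Lemma otensBl a a' b : (a - a') # b = a # b - a' # b.
Proof. exact: pureBl. Qed.

Lemma otensBr a b b' : a # (b - b') = a # b - a # b'.
Proof. exact: pureBr. Qed.

Lemma lactT_otens r a b : lactT r (a # b) = (iota r * a) # b.
Proof. by rewrite /lactT tlift_pure //; exact: lactT_balanced. Qed.

Lemma lactTD r : {morph lactT r : x y / x + y}.
Proof. exact: raddfD. Qed.

Lemma lactT_add r r' x : lactT (r + r') x = lactT r x + lactT r' x.
Proof.
move: x; apply: tensor_ext => [x y|x y|a b]; rewrite ?lactTD //; first exact: addrACA.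
by rewrite !lactT_otens rmorphD mulrDl otensDl.
Qed.

Lemma lactT_mul r r' x : lactT (r * r') x = lactT r (lactT r' x).
Proof.
move: x; apply: tensor_ext => [x y|x y|a b]; rewrite ?lactTD //.
by rewrite !lactT_otens rmorphM mulrA.
Qed.

Lemma lactT1 x : lactT 1 x = x.
Proof.
move: x; apply: tensor_ext => [x y|x y|a b]; rewrite ?lactTD //.
by rewrite lactT_otens rmorph1 mul1r.
Qed.

Lemma lact_skew : skew_module act dem (fun r => lact iota r) (fun s => *%R (D s)).
Proof.
split=> [r r' h|r r' h|s h h'|s r h] /=; rewrite /lact.
- by rewrite rmorphD mulrDl.
- by rewrite rmorphM mulrA.
- exact: mulrDr.
- by rewrite mulrA (nc_cross nc) mulrDl mulrA.
Qed.

Definition Dop s : T -> T :=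
  skew_op al (fun s => *%R (D s)) (fun s => *%R (D s)) s.

Lemma DopE s a b : Dop s (a # b) = (D s * a) # b + (hw s * a) # (D s * b).
Proof.
rewrite /Dop (skew_opE (nc_demE nc) lact_skew lact_skew) /= /lact.
by rewrite /hw mulrBl mul1r mulrA.
Qed.

(** In the term alpha Da (x) Db the factor alpha may be read on either side, which moves s from the
    left factor to the right one. *)
Lemma DopE' s a b : Dop s (a # b) = (D s * a) # (hw s * b) + a # (D s * b).
Proof.
rewrite DopE /hw !mulrBl !mul1r otensBl otensBr -!mulrA otens_iota.
by rewrite addrA addrAC.
Qed.

Lemma DopD s : {morph Dop s : x y / x + y}.
Proof. exact: (skew_opD (nc_demE nc) lact_skew lact_skew). Qed.

Lemma Dop_lactT s r x :
  Dop s (lactT r x) = lactT (act s r) (Dop s x) + lactT (dem s r) x.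
Proof.
move: x; apply: tensor_ext => [x y|x y|a b]; rewrite ?lactTD ?DopD ?lactTD //.
  exact: addrACA.
rewrite !lactT_otens !DopE lactTD !lactT_otens !mulrA hw_iota (nc_cross nc).
by rewrite mulrDl otensDl addrAC.
Qed.

(** Apart from squares of D, the terms left are sDa (x) Db and Dsa (x) Db; they cancel since sD = D
    and Ds = -D. *)
Lemma Dop_sq s x : Dop s (Dop s x) = 0.
Proof.
move: x; apply: tensor_ext => [x y|x y|a b]; rewrite ?DopD ?addr0 //.
rewrite DopE DopD !DopE !mulrA (nc_sq nc) !mul0r !otens0l !otens0r add0r addr0.
by rewrite hw_D D_hw mulNr otensNl addrN.
Qed.

Definition rmul_pure c e a b : T := (a * c) # (b * e).

Lemma rmul_balanced c e :
  balanced (fun r => lact iota r) (fun r => lact iota r) (rmul_pure c e).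
Proof.
split=> [b a a'|a b b'|r a b]; rewrite /rmul_pure /= /lact.
- by rewrite mulrDl otensDl.
- by rewrite mulrDl otensDr.
- by rewrite -!mulrA otens_iota.
Qed.

Definition rmul c e : T -> T := tlift (rmul_pure c e).

Lemma rmulE c e a b : rmul c e (a # b) = (a * c) # (b * e).
Proof. by rewrite /rmul tlift_pure //; exact: rmul_balanced. Qed.

Lemma rmulD c e : {morph rmul c e : x y / x + y}.
Proof. exact: tlift_add (rmul_balanced c e). Qed.

Lemma rmul_lactT c e r x : rmul c e (lactT r x) = lactT r (rmul c e x).
Proof.
move: x; apply: tensor_ext => [x y|x y|a b]; rewrite ?lactTD ?rmulD ?lactTD //.
by rewrite lactT_otens !rmulE lactT_otens mulrA.
Qed.

(** Left and right multiplications commute. Identities between words in [Dop] thereby reduce to 1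
    (x) 1. *)
Lemma rmul_Dop c e s x : rmul c e (Dop s x) = Dop s (rmul c e x).
Proof.
move: x; apply: tensor_ext => [x y|x y|a b]; rewrite ?DopD ?rmulD ?DopD //.
by rewrite DopE rmulD !rmulE DopE !mulrA.
Qed.

Section Rep.
Variable rho : H -> R -> R.

Record polynomial_rep : Prop := {
  pr_Dl : forall h h' f, rho (h + h') f = rho h f + rho h' f;
  pr_Dr : forall h, {morph rho h : f g / f + g};
  pr_1 : forall f, rho 1 f = f;
  pr_M : forall h h' f, rho (h * h') f = rho h (rho h' f);
  pr_iota : forall r f, rho (iota r) f = r * f;
  pr_D : forall s f, rho (D s) f = dem s f
}.

Hypothesis pr : polynomial_rep.

Lemma pr_B h h' f : rho (h - h') f = rho h f - rho h' f.
Proof. by apply: (@addIr _ (rho h' f)); rewrite -(pr_Dl pr) !subrK. Qed.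

Lemma pr_hw s f : rho (hw s) f = act s f.
Proof.
by rewrite pr_B (pr_1 pr) (pr_M pr) (pr_iota pr) (pr_D pr) (nc_demE nc) opprB addrC subrK.
Qed.

Lemma rho_iota_inj : injective iota.
Proof. by move=> r r' e; rewrite -[r]mulr1 -[r']mulr1 -!(pr_iota pr) e. Qed.

Definition pair_pure f g a b : R := rho a f * rho b g.

Lemma pair_balanced f g :
  balanced (fun r => lact iota r) (fun r => lact iota r) (pair_pure f g).
Proof.
split=> [b a a'|a b b'|r a b]; rewrite /pair_pure /= /lact.
- by rewrite (pr_Dl pr) mulrDl.
- by rewrite (pr_Dl pr) mulrDr.
- by rewrite !(pr_M pr) !(pr_iota pr) mulrAC mulrC mulrA.
Qed.

Definition pairT f g : T -> R := tlift (pair_pure f g).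

Lemma pairTE f g a b : pairT f g (a # b) = rho a f * rho b g.
Proof. by rewrite /pairT tlift_pure //; exact: pair_balanced. Qed.

Lemma pairTD f g : {morph pairT f g : x y / x + y}.
Proof. exact: tlift_add (pair_balanced f g). Qed.

Hypothesis demM : forall s f g, dem s (f * g) = dem s f * g + act s f * dem s g.
Hypothesis demD : forall s, {morph dem s : f g / f + g}.

(** The diagonal formula for D mirrors the twisted Leibniz rule, so acting on the tensor and then
    multiplying is multiplying and then acting. *)
Lemma pairT_Dop f g s x : pairT f g (Dop s x) = dem s (pairT f g x).
Proof.
move: x; apply: tensor_ext => [x y|x y|a b]; rewrite ?DopD ?pairTD ?demD //.
by rewrite DopE pairTD !pairTE !(pr_M pr) pr_hw !(pr_D pr) demM.
Qed.

Section Braid.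
Variables (l : bool -> S) (m : nat).
Local Notation word b n := (alt_word (fun c x => D (l c) * x) b n 1).
Local Notation Dword := (alt_word (fun b => Dop (l b))).
Local Notation dword := (alt_word (fun b => dem (l b))).
Local Notation basis j := (word (odd j) (uphalf j)).
Local Notation dbasis j f := (dword (odd j) (uphalf j) f).

Hypothesis m_gt0 : (0 < m)%N.
Hypothesis word_braid : word true m = word false m.
Hypothesis dword_braid : forall f, dword true m f = dword false m f.
Hypothesis dbasis_indep : forall e : nat -> R,
  (forall f, \sum_(j < m.*2) e j * dbasis j f = 0) ->
  forall j, (j < m.*2)%N -> e j = 0.

(** Stable under left multiplication by R and by both letters, see [in_spanZ] and [in_span_D]: the
    rank two nil Hecke algebra with coefficients in R. *)
Definition in_span h := exists e : nat -> R, h = \sum_(j < m.*2) iota (e j) * basis j.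

Lemma in_spanD h h' : in_span h -> in_span h' -> in_span (h + h').
Proof.
move=> [e ->] [e' ->]; exists (fun j => e j + e' j); rewrite -big_split /=.
by apply: eq_bigr => j _; rewrite rmorphD mulrDl.
Qed.

Lemma in_spanZ r h : in_span h -> in_span (iota r * h).
Proof.
move=> [e ->]; exists (fun j => r * e j); rewrite mulr_sumr.
by apply: eq_bigr => j _; rewrite rmorphM mulrA.
Qed.

Lemma in_span0 : in_span 0.
Proof.
by exists (fun=> 0); rewrite big1 // => j _; rewrite rmorph0 mul0r.
Qed.

Lemma in_spanN h : in_span h -> in_span (- h).
Proof. by move=> /(in_spanZ (- 1)); rewrite rmorphN rmorph1 mulN1r. Qed.

Lemma in_span_basis j : (j < m.*2)%N -> in_span (basis j).
Proof.
move=> ltj; exists (fun i => (i == j)%:R).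
rewrite (bigD1 (Ordinal ltj)) //= eqxx rmorph1 mul1r big1 ?addr0 // => i.
by rewrite -val_eqE /= => /negPf ->; rewrite rmorph0 mul0r.
Qed.

Lemma in_span_word b n : (n <= m)%N -> in_span (word b n).
Proof.
have span j b' n' : odd j = b' -> uphalf j = n' -> (j < m.*2)%N -> in_span (word b' n').
  by move=> <- <-; exact: in_span_basis.
case: n => [_|n ltnm]; first by apply: (@span 0%N false 0%N) => //; lia.
case: b; first by apply: (@span n.*2.+1); lia.
have [mn|neq] := eqVneq n.+1 m; last by apply: (@span n.+1.*2); lia.
(* The longest word ending in [false] would have index [m.*2], out of range; it is replaced by the
   one ending in [true]. *)
by rewrite mn -word_braid -mn; apply: (@span n.*2.+1); lia.
Qed.

Lemma D_word_next b n : D (l (b (+) odd n)) * word b n = word b n.+1.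
Proof. by rewrite alt_word_recl. Qed.

Lemma in_span_Dword c b n : (n <= m)%N -> in_span (D (l c) * word b n).
Proof.
have same b' n' : in_span (D (l (b' (+) odd n')) * word b' n'.+1).
  by rewrite alt_word_recl mulrA (nc_sq nc) mul0r; exact: in_span0.
case: n => [_|n ltnm]; first exact: (@in_span_word c 1%N m_gt0).
have [<-|neqc] := eqVneq (b (+) odd n) c; first exact: same.
have ec : c = b (+) odd n.+1 by case: (b) (c) neqc => -[] /=; case: (odd n).
have [mn|neq] := eqVneq n.+1 m; last first.
  by rewrite ec D_word_next; apply: in_span_word; lia.
(* A word of full length may be rewritten with [c] as its leftmost letter; the product then contains
   a square and vanishes. *)
have -> : word b n.+1 = word (~~ b) n.+1.
  by rewrite mn; case: (b); rewrite word_braid.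
have -> : c = ~~ b (+) odd n by rewrite ec /= addNb addbN.
exact: same.
Qed.

Lemma in_span_D c h : in_span h -> in_span (D (l c) * h).
Proof.
move=> [e ->]; rewrite mulr_sumr; apply: (big_ind in_span); first exact: in_span0.
  exact: in_spanD.
move=> j _; rewrite mulrA (nc_cross nc) mulrDl -mulrA.
apply: in_spanD; apply: in_spanZ; last exact: in_span_basis.
by apply: in_span_Dword; have := ltn_ord j; lia.
Qed.

Lemma rho_word b n f : rho (word b n) f = dword b n f.
Proof.
elim: n => [|n IHn]; first exact: (pr_1 pr).
by rewrite !alt_word_recl (pr_M pr) IHn (pr_D pr).
Qed.

Lemma rho_sum (I : Type) (r : seq I) (F : I -> H) f :
  rho (\sum_(i <- r) F i) f = \sum_(i <- r) rho (F i) f.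
Proof. by apply: (@morph_sum _ _ (fun h => rho h f)) => h h'; exact: (pr_Dl pr). Qed.

Lemma span_faithful h : in_span h -> (forall f, rho h f = 0) -> h = 0.
Proof.
move=> [e ->] h0; apply: big1 => j _; rewrite (dbasis_indep _ (ltn_ord j)) ?rmorph0 ?mul0r // => f.
rewrite -[RHS](h0 f) rho_sum; apply: eq_bigr => i _.
by rewrite (pr_M pr) (pr_iota pr) rho_word.
Qed.

(** Coefficients are gathered in the second factor, so that independence can be applied to the words
    in the first. *)
Definition in_spanT x := exists2 y : nat -> H, forall j, in_span (y j) &
  x = \sum_(j < m.*2) basis j # y j.

Lemma in_spanTD x x' : in_spanT x -> in_spanT x' -> in_spanT (x + x').
Proof.
move=> [y yM ->] [y' yM' ->]; exists (fun j => y j + y' j).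
  by move=> j; exact: in_spanD.
by rewrite -big_split /=; apply: eq_bigr => j _; rewrite otensDr.
Qed.

Lemma in_spanTN x : in_spanT x -> in_spanT (- x).
Proof.
move=> [y yM ->]; exists (fun j => - y j) => [j|]; first exact: in_spanN.
by rewrite -sumrN; apply: eq_bigr => j _; rewrite otensNr.
Qed.

Lemma in_spanT_otens a b : in_span a -> in_span b -> in_spanT (a # b).
Proof.
move=> [e ->] bM; exists (fun j => iota (e j) * b) => [j|]; first exact: in_spanZ.
rewrite (@morph_sum _ _ (fun a => a # b)) => [|a' a'']; last exact: otensDl.
by apply: eq_bigr => j _; rewrite otens_iota.
Qed.

Lemma in_spanT_Dop c x : in_spanT x -> in_spanT (Dop (l c) x).
Proof.
move=> [y yM ->]; rewrite (morph_sum _ _ _ (DopD (l c))).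
apply: (big_ind in_spanT) => [||j _]; last first.
- have bM : in_span (basis j) by exact: in_span_basis.
  rewrite DopE'; apply: in_spanTD; apply: in_spanT_otens => //; try exact: in_span_D.
  rewrite mulrBl mul1r -mulrA; apply: in_spanD => //; apply: in_spanN.
  by apply: in_spanZ; exact: in_span_D.
- exact: in_spanTD.
- by rewrite -(otens0l 0); apply: in_spanT_otens; exact: in_span0.
Qed.

(* Independence of the operators [dbasis j] is applied once to each tensor
   factor. *)
Lemma spanT_faithful x : in_spanT x -> (forall f g, pairT f g x = 0) -> x = 0.
Proof.
move=> [y yM ->] x0; apply: big1 => j _.
rewrite [y j]span_faithful ?otens0r // => g.
apply: (@dbasis_indep (fun j => rho (y j) g)) => // f.
rewrite -[RHS](x0 f g) (morph_sum _ _ _ (pairTD f g)); apply: eq_bigr => i _.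
by rewrite pairTE rho_word mulrC.
Qed.

Lemma Dword_braid1 : Dword true m (1 # 1) = Dword false m (1 # 1).
Proof.
have one_span : in_span 1 by exact: (@in_span_word true 0).
have span b n : in_spanT (Dword b n (1 # 1)).
  elim: n => [|n IHn]; first exact: in_spanT_otens.
  by rewrite alt_word_recl; exact: in_spanT_Dop.
have pairE f g b n : pairT f g (Dword b n (1 # 1)) = dword b n (f * g).
  elim: n => [|n IHn]; first by rewrite /= pairTE !(pr_1 pr).
  by rewrite !alt_word_recl pairT_Dop IHn.
apply/eqP; rewrite -subr_eq0; apply/eqP/spanT_faithful.
  by apply: in_spanTD; rewrite //; exact: in_spanTN.
move=> f g; apply: (@addIr _ (pairT f g (Dword false m (1 # 1)))).
by rewrite -pairTD subrK !pairE add0r dword_braid.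
Qed.

Lemma Dword_braid x : Dword true m x = Dword false m x.
Proof.
have DwordD b n : {morph Dword b n : x y / x + y}.
  by elim: n b => [//|n IHn] b u v /=; rewrite DopD IHn.
have Dword_rmul b n c e u : Dword b n (rmul c e u) = rmul c e (Dword b n u).
  by elim: n b u => [//|n IHn] b u /=; rewrite -rmul_Dop IHn.
move: x; apply: tensor_ext => // a b.
(* Every pure tensor is a right multiple of 1 (x) 1, and right multiplications commute with the
   words. *)
have -> : pure _ _ a b = rmul a b (1 # 1) by rewrite rmulE !mul1r.
by rewrite !Dword_rmul Dword_braid1.
Qed.

End Braid.
End Rep.
End CrossRelations.

(** * The Hopf algebroid structure *)

Section DiagonalAction.
Variables (R : comPzRingType) (H : pzRingType) (iota : {rmorphism R -> H}).
Variables (S : Type) (act dem : S -> R -> R) (al : S -> R) (D : S -> H).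
Hypothesis nc : nil_cross iota act dem al D.
Variable rho : H -> R -> R.
Hypothesis pr : polynomial_rep iota dem D rho.
Local Notation T := (HoH iota).
Local Notation lactT := (@lactT R H iota).
Local Notation Dop := (@Dop R H iota S al D).
Local Notation hw := (@hw R H iota S al D).
Local Notation rmul := (@rmul R H iota).
Local Notation "a # b" := (otens iota a b) (at level 35).

Variable ac : H -> T -> T.

Record diagonal_action : Prop := {
  ac_Dl : forall h h' x, ac (h + h') x = ac h x + ac h' x;
  ac_Dr : forall h, {morph ac h : x y / x + y};
  ac_1 : forall x, ac 1 x = x;
  ac_M : forall h h' x, ac (h * h') x = ac h (ac h' x);
  ac_iota : forall r x, ac (iota r) x = lactT r x;
  ac_D : forall s x, ac (D s) x = Dop s x
}.

Hypothesis da : diagonal_action.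

Hypothesis gen_ind : forall P : H -> Prop,
  P 1 -> (forall x y, P x -> P y -> P (x + y)) ->
  (forall r x, P x -> P (iota r * x)) ->
  (forall s x, P x -> P (D s * x)) -> forall x, P x.

Definition diag h : T := ac h (1 # 1).
Definition counit h : R := rho h 1.

Lemma rmul_ac c e h x : rmul c e (ac h x) = ac h (rmul c e x).
Proof.
elim/gen_ind: h x => [|h h' IH IH'|r h IH|s h IH] x.
- by rewrite !(ac_1 da).
- by rewrite !(ac_Dl da) rmulD IH IH'.
- by rewrite !(ac_M da) !(ac_iota da) rmul_lactT IH.
- by rewrite !(ac_M da) !(ac_D da) (rmul_Dop nc) IH.
Qed.

Lemma ac_otens h a b : ac h (a # b) = rmul a b (diag h).
Proof. by rewrite rmul_ac rmulE !mul1r. Qed.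

Lemma diagD : {morph diag : h h' / h + h'}.
Proof. by move=> h h'; exact: (ac_Dl da). Qed.

Lemma diag1 : diag 1 = 1 # 1.
Proof. exact: (ac_1 da). Qed.

Lemma diag_iota r h : diag (iota r * h) = lactT r (diag h).
Proof. by rewrite /diag (ac_M da) (ac_iota da). Qed.

Lemma diag_D s h : diag (D s * h) = Dop s (diag h).
Proof. by rewrite /diag (ac_M da) (ac_D da). Qed.

Lemma diagN h : diag (- h) = - diag h.
Proof. by apply/eqP; rewrite -addr_eq0 -diagD addNr (morph_add0 diagD). Qed.

Lemma diag_hw s h : diag (hw s * h) = diag h - lactT (al s) (Dop s (diag h)).
Proof. by rewrite mulrBl mul1r -mulrA diagD diagN diag_iota diag_D. Qed.

Lemma counitD : {morph counit : h h' / h + h'}.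
Proof. by move=> h h'; exact: (pr_Dl pr). Qed.

Lemma counit_iota r h : counit (iota r * h) = r * counit h.
Proof. by rewrite /counit (pr_M pr) (pr_iota pr). Qed.

Lemma counit_D s h : counit (D s * h) = dem s (counit h).
Proof. by rewrite /counit (pr_M pr) (pr_D pr). Qed.

Lemma counit_hw s h : counit (hw s * h) = act s (counit h).
Proof. by rewrite /counit (pr_M pr) (pr_hw nc pr). Qed.

Lemma counit1 : counit 1 = 1.
Proof. exact: (pr_1 pr). Qed.

Local Notation eps_l := (tlift (fun a b => iota (counit a) * b)).
Local Notation eps_r := (tlift (fun a b => iota (counit b) * a)).

Lemma eps_l_balanced : balanced (fun r => lact iota r) (fun r => lact iota r)
  (fun a b => iota (counit a) * b).
Proof.
split=> [b a a'|a b b'|r a b].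
- by rewrite counitD rmorphD mulrDl.
- by rewrite mulrDr.
- by rewrite /= /lact counit_iota mulrC rmorphM mulrA.
Qed.

Lemma eps_r_balanced : balanced (fun r => lact iota r) (fun r => lact iota r)
  (fun a b => iota (counit b) * a).
Proof.
split=> [b a a'|a b b'|r a b].
- by rewrite mulrDr.
- by rewrite counitD rmorphD mulrDl.
- by rewrite /= /lact counit_iota mulrC rmorphM mulrA.
Qed.
Lemma counital_diag_l h : eps_l (diag h) = h.
Proof.
have epsD := tlift_add eps_l_balanced.
have epsE a b : eps_l (a # b) = iota (counit a) * b := tlift_pure eps_l_balanced a b.
elim/gen_ind: h => [|h h' IH IH'|r h IH|s h IH].
- by rewrite diag1 epsE counit1 rmorph1 mul1r.
- by rewrite diagD epsD IH IH'.
- rewrite diag_iota -[in RHS]IH; move: (diag h).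
  apply: tensor_ext => [x y|x y|a b]; rewrite ?lactTD ?epsD ?mulrDr //.
  by rewrite lactT_otens !epsE counit_iota rmorphM mulrA.
- rewrite diag_D -[in RHS]IH; move: (diag h).
  apply: tensor_ext => [x y|x y|a b]; rewrite ?(DopD nc) ?epsD ?mulrDr //.
  rewrite (DopE nc) epsD !epsE counit_D counit_hw !mulrA (nc_cross nc).
  by rewrite mulrDl addrC.
Qed.

Lemma counital_diag_r h : eps_r (diag h) = h.
Proof.
have epsD := tlift_add eps_r_balanced.
have epsE a b : eps_r (a # b) = iota (counit b) * a := tlift_pure eps_r_balanced a b.
elim/gen_ind: h => [|h h' IH IH'|r h IH|s h IH].
- by rewrite diag1 epsE counit1 rmorph1 mul1r.
- by rewrite diagD epsD IH IH'.
- rewrite diag_iota -[in RHS]IH; move: (diag h).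
  apply: tensor_ext => [x y|x y|a b]; rewrite ?lactTD ?epsD ?mulrDr //.
  by rewrite lactT_otens !epsE !mulrA -!rmorphM mulrC.
- rewrite diag_D -[in RHS]IH; move: (diag h).
  apply: tensor_ext => [x y|x y|a b]; rewrite ?(DopD nc) ?epsD ?mulrDr //.
  rewrite (DopE' nc) epsD !epsE counit_D counit_hw !mulrA (nc_cross nc).
  by rewrite mulrDl.
Qed.

(** The two sides are the right multiples of [diag h] by r (x) 1 and 1 (x) r; these multiplications
    commute with the action and agree on 1 (x) 1. *)
Lemma diag_takeuchi h : in_takeuchi (diag h).
Proof.
move=> r; transitivity (rmul (iota r) 1 (diag h)).
  by apply: eq_tlift => a b; rewrite /rmul_pure mulr1.
transitivity (rmul 1 (iota r) (diag h)); last first.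
  by apply: eq_tlift => a b; rewrite /rmul_pure mulr1.
rewrite !rmul_ac !rmulE !mul1r; congr (ac h _).
by rewrite -[iota r in LHS]mulr1 otens_iota mulr1.
Qed.

(** With this, multiplicativity of [diag] is associativity of the action. *)
Lemma omul_diag h y : omul (diag h) y = ac h y.
Proof.
rewrite -[RHS](tlift_additive y (ac_Dr da h)).
by apply: eq_tlift => c d; rewrite -[RHS]/(ac h (c # d)) ac_otens.
Qed.

Lemma diagM h h' : diag (h * h') = omul (diag h) (diag h').
Proof. by rewrite omul_diag /diag (ac_M da). Qed.

Local Notation TT := (HoHoH iota).
Local Notation "x #3 b" := (otensT (iota:=iota) x b) (at level 36).

Lemma otensT_iota r x b : (lactT r x) #3 b = x #3 (iota r * b).
Proof. exact: (pure_bal (fun r => lactT r) (fun r => lact iota r)). Qed.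

Lemma otensTDl x y b : (x + y) #3 b = x #3 b + y #3 b.
Proof. exact: pureDl. Qed.

Lemma otensTDr x b b' : x #3 (b + b') = x #3 b + x #3 b'.
Proof. exact: pureDr. Qed.

Lemma HoH_skew : skew_module act dem (fun r => lactT r) Dop.
Proof.
split=> [r r' x|r r' x|s x y|s r x].
- exact: lactT_add.
- exact: lactT_mul.
- exact: (DopD nc).
- exact: (Dop_lactT nc).
Qed.

Definition lactTT r : TT -> TT := tlift (fun x b => (lactT r x) #3 b).

Lemma lactTT_balanced r :
  balanced (fun r => lactT r) (fun r => lact iota r) (fun x b => (lactT r x) #3 b).
Proof.
apply: left_balanced => [|r' x] /=; first exact: lactTD.
by rewrite -!lactT_mul mulrC.
Qed.

Definition Dop3 s : TT -> TT := skew_op al Dop (fun s => *%R (D s)) s.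

Lemma Dop3D s : {morph Dop3 s : x y / x + y}.
Proof. exact: (skew_opD (nc_demE nc) HoH_skew (lact_skew nc)). Qed.

Lemma Dop3E s x b : Dop3 s (x #3 b) =
  (Dop s x) #3 b + (x - lactT (al s) (Dop s x)) #3 (D s * b).
Proof. exact: (skew_opE (nc_demE nc) HoH_skew (lact_skew nc)). Qed.

Lemma Delta_id_balanced : balanced (fun r => lact iota r) (fun r => lact iota r)
  (fun a b => (diag a) #3 b).
Proof.
split=> [b a a'|a b b'|r a b].
- by rewrite diagD otensTDl.
- by rewrite otensTDr.
- by rewrite /= /lact diag_iota otensT_iota.
Qed.

Definition assoc_left a : T -> TT := tlift (fun c d => (a # c) #3 d).

Lemma assoc_left_balanced a : balanced (fun r => lact iota r) (fun r => lact iota r)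
  (fun c d => (a # c) #3 d).
Proof.
split=> [d c c'|c d d'|r c d].
- by rewrite otensDr otensTDl.
- by rewrite otensTDr.
- by rewrite /= /lact -otens_iota -lactT_otens otensT_iota.
Qed.

Lemma assoc_leftE a c d : assoc_left a (c # d) = (a # c) #3 d.
Proof. by rewrite /assoc_left tlift_pure //; exact: assoc_left_balanced. Qed.

Lemma assoc_leftD a : {morph assoc_left a : x y / x + y}.
Proof. exact: tlift_add (assoc_left_balanced a). Qed.

Lemma assoc_leftDl a a' x : assoc_left (a + a') x = assoc_left a x + assoc_left a' x.
Proof.
move: x; apply: tensor_ext => [x y|x y|c d]; rewrite ?assoc_leftD //.
  exact: addrACA.
by rewrite !assoc_leftE otensDl otensTDl.
Qed.

Lemma assoc_left_lactT r a x : assoc_left (iota r * a) x = assoc_left a (lactT r x).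
Proof.
move: x; apply: tensor_ext => [x y|x y|c d]; rewrite ?lactTD ?assoc_leftD //.
by rewrite lactT_otens !assoc_leftE otens_iota.
Qed.

Lemma id_Delta_balanced : balanced (fun r => lact iota r) (fun r => lact iota r)
  (fun a b => assoc_left a (diag b)).
Proof.
split=> [b a a'|a b b'|r a b].
- exact: assoc_leftDl.
- by rewrite diagD assoc_leftD.
- by rewrite /= /lact diag_iota assoc_left_lactT.
Qed.

(** Since s acts on a tensor product as s (x) s, both bracketings give Da (x) c (x) d + sa (x) Dc
    (x) d + sa (x) sc (x) Dd. *)
Lemma assoc_left_Dop s a x :
  assoc_left (D s * a) x + assoc_left (hw s * a) (Dop s x) = Dop3 s (assoc_left a x).
Proof.
move: x; apply: tensor_ext => [x y|x y|c d].
- by rewrite (DopD nc) !assoc_leftD addrACA.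
- by rewrite assoc_leftD Dop3D.
rewrite (DopE nc) assoc_leftD !assoc_leftE Dop3E (DopE nc) otensTDl -addrA.
congr (_ + (_ + _ #3 _)).
rewrite lactTD !lactT_otens [hw s * c]mulrBl mul1r otensBr -mulrA -otens_iota.
rewrite opprD addrA; congr (_ - _).
by rewrite [in LHS]mulrBl mul1r otensBl -mulrA.
Qed.

(** Both maps turn left multiplication by a generator into the same operator on the triple tensor
    product, [lactTT] or [Dop3], and they agree at 1 (x) 1. *)
Lemma diag_coassoc h : Delta_id diag (diag h) = id_Delta diag (diag h).
Proof.
have DiE a b : Delta_id diag (a # b) = (diag a) #3 b := tlift_pure Delta_id_balanced a b.
have DiD := tlift_add Delta_id_balanced; rewrite -/(Delta_id diag) in DiD.
have iDE a b : id_Delta diag (a # b) = assoc_left a (diag b)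
  := tlift_pure id_Delta_balanced a b.
have iDD := tlift_add id_Delta_balanced; rewrite -/(id_Delta diag) in iDD.
have L3E r x b : lactTT r (x #3 b) = (lactT r x) #3 b
  := tlift_pure (lactTT_balanced r) x b.
have L3D r : {morph lactTT r : x y / x + y} := tlift_add (lactTT_balanced r).
elim/gen_ind: h => [|h h' IH IH'|r h IH|s h IH].
- by rewrite diag1 DiE iDE diag1 assoc_leftE.
- by rewrite diagD DiD iDD IH IH'.
- rewrite diag_iota; transitivity (lactTT r (Delta_id diag (diag h))); last rewrite IH.
    move: (diag h); apply: tensor_ext => [x y|x y|a b].
    + by rewrite lactTD DiD.
    + by rewrite DiD L3D.
    + by rewrite lactT_otens !DiE L3E diag_iota.
  move: (diag h); apply: tensor_ext => [x y|x y|a b].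
  + by rewrite iDD L3D.
  + by rewrite lactTD iDD.
  rewrite lactT_otens !iDE; move: (diag b); apply: tensor_ext => [x y|x y|c d].
  + by rewrite assoc_leftD L3D.
  + by rewrite assoc_leftD.
  by rewrite !assoc_leftE L3E lactT_otens.
- rewrite diag_D; transitivity (Dop3 s (Delta_id diag (diag h))); last rewrite IH.
    move: (diag h); apply: tensor_ext => [x y|x y|a b].
    + by rewrite (DopD nc) DiD.
    + by rewrite DiD Dop3D.
    + by rewrite (DopE nc) DiD !DiE Dop3E diag_D diag_hw.
  move: (diag h); apply: tensor_ext => [x y|x y|a b].
  + by rewrite iDD Dop3D.
  + by rewrite (DopD nc) iDD.
  by rewrite (DopE nc) iDD !iDE diag_D assoc_left_Dop.
Qed.

Lemma diag_bialgebroid : bialgebroid diag counit.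
Proof.
split.
- exact: (rho_iota_inj pr).
- exact: diagD.
- exact: diag_iota.
- exact: counitD.
- exact: counit_iota.
- exact: diag_coassoc.
- exact: counital_diag_l.
- exact: counital_diag_r.
- exact: diag_takeuchi.
- exact: diag1.
- exact: diagM.
- by move=> r; rewrite mul1r -[iota r]mulr1 counit_iota counit1 mulr1.
- by move=> h h' r; rewrite /counit !(pr_M pr) (pr_iota pr (rho _ _)) mulr1.
- by move=> r' r; rewrite counit_iota -[iota r]mulr1 counit_iota counit1 mulr1.
Qed.

(** * Bijectivity of the Galois map *)

Section Galois.
Variable tau : H -> H.
Hypotheses (tauD : {morph tau : h h' / h + h'}) (tau1 : tau 1 = 1).
Hypothesis tauM : forall h h', tau (h * h') = tau h' * tau h.
Hypotheses (tau_iota : forall r, tau (iota r) = iota r) (tau_D : forall s, tau (D s) = D s).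

Lemma tauK : involutive tau.
Proof.
elim/gen_ind => [|h h' IH IH'|r h IH|s h IH]; first by rewrite !tau1.
- by rewrite !tauD IH IH'.
- by rewrite !tauM IH !tau_iota.
- by rewrite !tauM IH !tau_D.
Qed.

Lemma galois_balanced : balanced (fun r => lact iota r) (fun r => lact iota r)
  (fun a b => ac (tau a) (1 # b)).
Proof.
split=> [b a a'|a b b'|r a b].
- by rewrite tauD (ac_Dl da).
- by rewrite otensDr (ac_Dr da).
- by rewrite /= /lact tauM tau_iota (ac_M da) (ac_iota da) lactT_otens otens_iota.
Qed.

(* Composed with [a [x] b |-> tau a (x) b], this is the Galois map; since it is
   an involution, the Galois map is bijective. *)
Definition galois_inv : T -> T := tlift (fun a b => ac (tau a) (1 # b)).
Local Notation J := galois_inv.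

Lemma galois_invE a b : J (a # b) = ac (tau a) (1 # b).
Proof. exact: (tlift_pure galois_balanced a b). Qed.

Lemma galois_invD : {morph J : x y / x + y}.
Proof. exact: tlift_add galois_balanced. Qed.

Lemma galois_inv_lactT r x : J (lactT r x) = rmul (iota r) 1 (J x).
Proof.
move: x; apply: tensor_ext => [x y|x y|a b]; rewrite ?lactTD ?galois_invD ?rmulD //.
rewrite lactT_otens !galois_invE rmul_ac rmulE tauM tau_iota (ac_M da) (ac_iota da).
by rewrite lactT_otens mul1r !mulr1.
Qed.

(** With D(a (x) b) = Da (x) sb + a (x) Db, the first term yields D(1 (x) sb) = D (x) b - 1 (x) Db
    by s^2 = 1 and Ds = -D, and the second cancels the negative part. *)
Lemma galois_inv_Dop s x : J (Dop s x) = rmul (D s) 1 (J x).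
Proof.
move: x; apply: tensor_ext => [x y|x y|a b]; rewrite ?(DopD nc) ?galois_invD ?rmulD //.
rewrite (DopE' nc) galois_invD !galois_invE rmul_ac rmulE tauM tau_D (ac_M da) (ac_D da) (DopE' nc).
rewrite -(ac_Dr da) mulrA (hwK nc) mulrA (D_hw nc) mulNr otensNr mulr1 mul1r mulr1 mul1r.
by rewrite subrK.
Qed.

Lemma rmulM c e c' e' x : rmul c e (rmul c' e' x) = rmul (c' * c) (e' * e) x.
Proof.
move: x; apply: tensor_ext => [x y|x y|a b]; rewrite ?rmulD //.
by rewrite !rmulE !mulrA.
Qed.

Lemma galois_inv_ac h x : J (ac h x) = rmul (tau h) 1 (J x).
Proof.
elim/gen_ind: h x => [|h h' IH IH'|r h IH|s h IH] x.
- rewrite (ac_1 da) tau1; move: (J x); apply: tensor_ext => [y z|y z|a b]; rewrite ?rmulD //.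
  by rewrite rmulE !mulr1.
- rewrite (ac_Dl da) galois_invD IH IH' tauD; move: (J x).
  apply: tensor_ext => [y z|y z|a b]; rewrite ?rmulD //; first exact: addrACA.
  by rewrite !rmulE mulrDr otensDl.
- by rewrite (ac_M da) (ac_iota da) galois_inv_lactT IH rmulM tauM tau_iota mulr1.
- by rewrite (ac_M da) (ac_D da) galois_inv_Dop IH rmulM tauM tau_D mulr1.
Qed.

(** A second application turns the action of [tau a] on 1 (x) b into right multiplication of the
    first factor by [tau (tau a)], which restores a (x) b. *)
Lemma galois_invK : involutive J.
Proof.
apply: tensor_ext => [x y|//|a b]; first by rewrite !galois_invD.
by rewrite -/(a # b) galois_invE galois_inv_ac tauK galois_invE tau1 (ac_1 da) rmulE mul1r mulr1.
Qed.

Local Notation B := (HbH iota).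
Local Notation "a ## b" := (btens iota a b) (at level 35).

Lemma to_HoH_balanced : balanced (fun r => ract iota r) (fun r => lact iota r)
  (fun a b => (tau a) # b).
Proof.
split=> [b a a'|a b b'|r a b].
- by rewrite tauD otensDl.
- by rewrite otensDr.
- by rewrite /= /ract /lact tauM tau_iota otens_iota.
Qed.

Lemma to_HbH_balanced : balanced (fun r => lact iota r) (fun r => lact iota r)
  (fun a b => (tau a) ## b).
Proof.
split=> [b a a'|a b b'|r a b].
- by rewrite tauD /btens pureDl.
- by rewrite /btens pureDr.
rewrite /= /lact tauM tau_iota.
exact: (pure_bal (fun r => ract iota r) (fun r => lact iota r)).
Qed.

(** Being an anti-morphism over R, [tau] exchanges right and left R-actions and thus identifies the
    two tensor products. *)
Definition to_HoH : B -> T := tlift (fun a b => (tau a) # b).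
Definition to_HbH : T -> B := tlift (fun a b => (tau a) ## b).

Lemma to_HoHK : cancel to_HoH to_HbH.
Proof.
apply: tensor_ext => [x y|//|a b].
  by rewrite /to_HoH (tlift_add to_HoH_balanced) /to_HbH (tlift_add to_HbH_balanced).
rewrite /to_HoH (tlift_pure to_HoH_balanced) /to_HbH.
by rewrite (tlift_pure to_HbH_balanced) tauK.
Qed.

Lemma to_HbHK : cancel to_HbH to_HoH.
Proof.
apply: tensor_ext => [x y|//|a b].
  by rewrite /to_HbH (tlift_add to_HbH_balanced) /to_HoH (tlift_add to_HoH_balanced).
rewrite /to_HbH (tlift_pure to_HbH_balanced) /to_HoH.
by rewrite (tlift_pure to_HoH_balanced) tauK.
Qed.

Lemma Gal_factor x : Gal diag x = J (to_HoH x).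
Proof.
have JtD : {morph (fun x => J (to_HoH x)) : x y / x + y}.
  by move=> y z; rewrite /to_HoH (tlift_add to_HoH_balanced) galois_invD.
rewrite -[RHS](tlift_additive x JtD); apply: eq_tlift => a b.
rewrite /to_HoH (tlift_pure to_HoH_balanced) galois_invE tauK ac_otens.
by apply: eq_tlift => c d; rewrite /rmul_pure mulr1.
Qed.

Lemma diag_hopf : hopf_algebroid diag counit.
Proof.
split; first exact: diag_bialgebroid.
exists (fun y => to_HbH (J y)) => x.
  by rewrite Gal_factor galois_invK to_HoHK.
by rewrite Gal_factor to_HbHK galois_invK.
Qed.

(** Reversal sends s = 1 - alpha D to 1 - D alpha, and D alpha = 2 - alpha D. *)
Lemma tau_hw s : tau (hw s) = - hw s.
Proof.
have tauN h : tau (- h) = - tau h.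
  by apply/eqP; rewrite -addr_eq0 -tauD addNr (morph_add0 tauD).
rewrite tauD tau1 tauN tauM tau_iota tau_D (D_al nc) opprB /hw opprB addrCA.
by congr (_ + _); rewrite mulr2n opprD addrA subrr add0r.
Qed.

(** As J is an involution, red D corresponds to J (D (x) 1) = D (x) 1 + s (x) D; transport by [tau]
    produces the sign, since [tau] sends s to -s. *)
Lemma red_D red s : is_red diag red ->
  red (D s) = (D s) ## 1 - (hw s) ## (D s).
Proof.
move=> redP; have := redP (D s); rewrite Gal_factor => /(congr1 J).
rewrite galois_invK galois_invE tau_D (ac_D da) (DopE nc) !mulr1 => e.
rewrite -[LHS]to_HoHK e /to_HbH (tlift_add to_HbH_balanced) !(tlift_pure to_HbH_balanced).
by rewrite tau_D tau_hw; congr (_ + _); exact: pureNl.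
Qed.

End Galois.

(** A comultiplication is R-linear and multiplicative, so its values on all D (s in S) determine it.
    The resulting theorem applies to every structure and not just to the one constructed. *)
Lemma diag_uniq (Delta : H -> T) (eps : H -> R) : bialgebroid Delta eps ->
  (forall s, Delta (D s) = (D s) # 1 + (hw s) # (D s)) -> Delta =1 diag.
Proof.
move=> bi DeltaE; elim/gen_ind => [|h h' IH IH'|r h IH|s h IH].
- by rewrite (Delta1 bi) diag1.
- by rewrite (DeltaD bi) diagD IH IH'.
- by rewrite (DeltaZ bi) diag_iota IH.
rewrite (DeltaM bi) DeltaE diag_D -IH -[RHS](tlift_additive _ (DopD nc s)).
apply: eq_tlift => c d; rewrite -[LHS]/(rmul c d _) -[pure _ _ c d]/(c # d).
by rewrite rmulD !rmulE (DopE nc) mul1r.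
Qed.
End DiagonalAction.

(** * The nil Hecke algebra *)

Section CrossGen.
Variables (R : comPzRingType) (H : pzRingType) (iota : {rmorphism R -> H}) (d : H).
Implicit Types f g : R.

(** The values [af] and [df] are left free: the relation is stable under sums and products, so for
    polynomials it follows from the case of linear forms. *)
Definition crosses f af df := d * iota f = iota af * d + iota df.

Lemma crossesD f af df g ag dg : crosses f af df -> crosses g ag dg ->
  crosses (f + g) (af + ag) (df + dg).
Proof. by rewrite /crosses !rmorphD mulrDr mulrDl => -> ->; rewrite addrACA. Qed.

Lemma crossesM f af df g ag dg : crosses f af df -> crosses g ag dg ->
  crosses (f * g) (af * ag) (df * g + af * dg).
Proof.
rewrite /crosses => ef eg.
rewrite rmorphM mulrA ef mulrDl -mulrA eg mulrDr mulrA -!rmorphM -addrA.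
by congr (_ + _); rewrite addrC -rmorphD.
Qed.

Lemma crosses_rev f af df : crosses af f (- df) ->
  iota f * d = d * iota af + iota df.
Proof. by rewrite /crosses => ->; rewrite rmorphN subrK. Qed.

End CrossGen.

Section NilHecke.
Variables (k : realType) (S : choiceType) (m : S -> S -> nat).
Hypothesis mss : forall s, m s s = 1%N.
Hypothesis msym : forall s t, m s t = m t s.
Hypothesis mneq1 : forall s t, s <> t -> m s t != 1%N.
Local Notation Sym := (Sym k S).
Local Notation nilH := (nilH k m).
Local Notation iota := (@Sym_to_nilH k S m).
Local Notation hD := (@hD k S m).
Local Notation hV := (@hV k S m).
Local Notation act := (@Sym_act k S m).
Local Notation dem := (@dem k S m).
Local Notation al := (fun s => Sym_of (alpha k s)).
Local Notation rho := (@rho k S m).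

Lemma iotaC c : iota c%:MP = pres_const (@nilH_rel k S m) c.
Proof.
rewrite -[LHS]/(Sym_in m _) Sym_inU hmon1.
by rewrite -[LHS]/(pres_mul (pres_const _ c) 1) pres_mulr1.
Qed.

Lemma scale_iota c (x : nilH) : c *: x = iota c%:MP * x.
Proof. by rewrite iotaC. Qed.

Lemma iota_of u : iota (Sym_of u) = hV u.
Proof. exact: Sym_in_of. Qed.

Lemma iota_commC c (x : nilH) : x * iota c%:MP = iota c%:MP * x.
Proof. by rewrite iotaC; symmetry; exact: pres_constC. Qed.

Lemma nilH_relE a b : nilH_rel m a b ->
  pres_pi (@nilH_rel k S m) a = pres_pi (@nilH_rel k S m) b.
Proof. by move=> ab; apply/pres_piP; exact: AE_rel. Qed.

Lemma hD_hV s u : crosses iota (hD s) (Sym_of u) (Sym_of (srefl m s u)) (pairing m u s)%:MP.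
Proof.
transitivity (hD s * hV u); first by congr (_ * _); exact: iota_of.
transitivity (hV (srefl m s u) * hD s + pres_const (@nilH_rel k S m) (pairing m u s)).
  rewrite [LHS]pres_mulE [X in _ = X + _]pres_mulE [RHS]pres_addE.
  by apply: nilH_relE; exact: NR_cross.
by congr (_ * _ + _); symmetry; [exact: iota_of|exact: iotaC].
Qed.

Lemma hD_iota s f : crosses iota (hD s) f (act s f) (dem s f).
Proof.
elim/Sym_gen_ind: f => [f g cf cg|c|t f cf].
- rewrite Sym_actD demD; apply: crossesD; [exact: cf|exact: cg].
- by rewrite /crosses Sym_actC demC rmorph0 addr0 iota_commC.
- rewrite Sym_actM demM; apply: crossesM; last exact: cf.
  by rewrite Sym_act_of dem_of; exact: hD_hV.
Qed.

Lemma hD_sq s : hD s * hD s = 0.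
Proof. by rewrite [LHS]pres_mulE; apply: nilH_relE; exact: NR_sq. Qed.

Lemma nilH_cross : nil_cross iota act dem al hD.
Proof.
split=> [s r|s|s r|s].
- exact: hD_iota.
- exact: hD_sq.
- exact: demE.
- by rewrite dem_of pairing_alpha_diag // mpolyC_nat.
Qed.

Lemma nilH_gen_ind (P : nilH -> Prop) :
  P 1 -> (forall x y, P x -> P y -> P (x + y)) ->
  (forall r x, P x -> P (iota r * x)) ->
  (forall s x, P x -> P (hD s * x)) -> forall x, P x.
Proof.
move=> P1 PD PR PS; apply: presented_alg_ind => // [c x Px|[u|s] x Px].
- by rewrite scale_iota; exact: PR.
- by rewrite -[pres_pi _ _]/(hV u) -iota_of; exact: PR.
- exact: PS.
Qed.

Let dom := dem_op_module k mss msym mneq1.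

Lemma rho_pi a f :
  rho (pres_pi (@nilH_rel k S m) a) f = term_op (fun c : k => *:%R c) (dem_op m) a f.
Proof. exact: (pres_act_pi dom). Qed.

Lemma rho_addl h h' f : rho (h + h') f = rho h f + rho h' f.
Proof. exact: (pres_actDl dom). Qed.

Lemma rho_mul h h' f : rho (h * h') f = rho h (rho h' f).
Proof. exact: (pres_actM dom). Qed.

Lemma rho_iota r f : rho (iota r) f = r * f.
Proof.
elim/Sym_gen_ind: r => [r r' IH IH'|c|t r IH].
- rewrite rmorphD rho_addl mulrDl; congr (_ + _); [exact: IH|exact: IH'].
- by rewrite iotaC rho_pi mul_malgC.
- rewrite rmorphM rho_mul iota_of -mulrA; transitivity (Sym_of (alpha k t) * rho (iota r) f).
    exact: rho_pi.
  congr (_ * _); exact: IH.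
Qed.

Lemma nilH_rep : polynomial_rep iota dem hD rho.
Proof.
split.
- exact: rho_addl.
- by move=> h f g; exact: (pres_actDr dom).
- by move=> f; exact: (pres_act1 dom).
- exact: rho_mul.
- exact: rho_iota.
- by move=> s f; exact: rho_pi.
Qed.

Lemma rho_demazure : demazure_rep rho.
Proof.
split.
- move=> h c f g; transitivity (rho h (c *: f) + rho h g); first exact: (pr_Dr nilH_rep).
  by congr (_ + _); symmetry; exact: (term_opC dom).
- move=> f c h h'; transitivity (rho (c *: h) f + rho h' f); first exact: rho_addl.
  by congr (_ + _); exact: (pres_actZ dom).
- exact: (pr_1 nilH_rep).
- exact: (pr_M nilH_rep).
- by move=> u f; rewrite -iota_of; exact: rho_iota.
- by move=> s f; rewrite (pr_D nilH_rep); exact: demE.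
Qed.

End NilHecke.

(** * The anti-automorphism [tau] and the diagonal action of the nil Hecke algebra *)

Section NilHeckeHopf.
Variables (k : realType) (S : choiceType) (m : S -> S -> nat).
Hypothesis mss : forall s, m s s = 1%N.
Hypothesis msym : forall s t, m s t = m t s.
Hypothesis mneq1 : forall s t, s <> t -> m s t != 1%N.
Local Notation Sym := (Sym k S).
Local Notation nilH := (nilH k m).
Local Notation iota := (@Sym_to_nilH k S m).
Local Notation hD := (@hD k S m).
Local Notation hV := (@hV k S m).
Local Notation act := (@Sym_act k S m).
Local Notation dem := (@dem k S m).
Local Notation al := (fun s => Sym_of (alpha k s)).
Local Notation rho := (@rho k S m).
Local Notation npi := (pres_pi (@nilH_rel k S m)).
Local Notation T := (HoH iota).
Local Notation Dop := (@Dop Sym nilH iota S al hD).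

Let nc : nil_cross iota act dem al hD := nilH_cross k mss.
Let pr : polynomial_rep iota dem hD rho := nilH_rep k mss msym mneq1.

Lemma npi_mul a b : npi (TMul a b) = npi a * npi b.
Proof. by symmetry; exact: pres_mulE. Qed.

Lemma nilH_braid s t : s <> t -> (0 < m s t)%N ->
  npi (braid_word k (m s t) s t) = npi (braid_word k (m s t) t s).
Proof. by move=> neq m_gt0; apply: nilH_relE; exact: NR_braid. Qed.

(** This is the crossing relation at s(f), because dem(s(f)) = -dem(f). *)
Lemma iota_hD s f : iota f * hD s = hD s * iota (act s f) + iota (dem s f).
Proof.
apply: crosses_rev; rewrite -dem_act // -[X in crosses _ _ _ X](Sym_actK mss s f).
exact: hD_iota.
Qed.

Lemma hV_hD s u : hV u * hD s = hD s * hV (srefl m s u) + pairing m u s *: (1 : nilH).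
Proof.
transitivity (iota (Sym_of u) * hD s); first by congr (_ * _); symmetry; exact: iota_of.
rewrite iota_hD Sym_act_of dem_of; congr (_ * _ + _); first exact: iota_of.
by rewrite -[LHS]mulr1; symmetry; exact: scale_iota.
Qed.

(** Right multiplications compose in reversed order, so a module structure made of them yields an
    anti-endomorphism by evaluation at 1; this is [tau]. *)
Definition right_gen (g : nilH_gen k S) (v : nilH) : nilH := v * npi (TVar g).

Lemma right_word (s t : S) n b v :
  alt_word (fun b => right_gen (GenD k (if b then s else t))) b n v =
  v * npi (if b then braid_word k n s t else braid_word k n t s).
Proof.
elim: n b v => [|n IHn] b v; first by case: b; symmetry; exact: mulr1.
rewrite [LHS]IHn /right_gen -mulrA -npi_mul; congr (_ * npi _).
by case: b.
Qed.

Lemma right_module : term_module (fun c : k => *:%R c) right_gen (@nilH_rel k S m).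
Proof.
split.
- by move=> g u v; exact: mulrDl.
- by move=> c u v; exact: scalerDr.
- by move=> c c' v; exact: scalerDl.
- by move=> c c' v; symmetry; exact: scalerA.
- by move=> v; exact: scale1r.
- by move=> c g v; exact: pres_scalerAl.
- move=> a b; case=> {a b}.
  + move=> c u w v; rewrite /= /right_gen; transitivity (v * (c *: hV u + hV w)).
      by congr (_ * _); exact: hV_lin.
    by rewrite mulrDr; congr (_ + _); symmetry; exact: pres_scalerAr.
  + move=> u w v; rewrite /= /right_gen -!mulrA; congr (_ * _); exact: hV_comm.
  + move=> s u v; rewrite /= /right_gen -!mulrA; transitivity (v * (hV u * hD s)) => //.
    rewrite hV_hD mulrDr; congr (_ + _).
    by rewrite -[in RHS](mulr1 v); symmetry; exact: pres_scalerAr.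
  + move=> s v; rewrite /= /right_gen -!mulrA; transitivity (v * (hD s * hD s)) => //.
    by rewrite hD_sq mulr0; symmetry; exact: scale0r.
  + move=> s t neq m_gt0 v.
    have bw b := @term_op_braid k S nilH (fun c => *:%R c) right_gen s t (m s t) b v
      (@scale1r _ _).
    (* Reversing a braid word gives one of the two braid words, which one depending on the parity of
       its length; the relation is symmetric in them. *)
    pose bword b := npi (if b then braid_word k (m s t) s t else braid_word k (m s t) t s).
    transitivity (v * bword (true (+) ~~ odd (m s t))).
      by rewrite /bword -right_word; exact: (bw true).
    transitivity (v * bword (false (+) ~~ odd (m s t))).
      by congr (_ * _); rewrite /bword; case: (odd _) => /=; rewrite (nilH_braid neq).
    by rewrite /bword -right_word; symmetry; exact: (bw false).
Qed.

Definition tau (h : nilH) : nilH :=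
  pres_act (fun c : k => *:%R c) right_gen h (1 : nilH).

Lemma tau_act h v :
  pres_act (fun c : k => *:%R c) right_gen h v = v * tau h.
Proof.
move: h v; apply: presented_alg_ind => [|x y IHx IHy|c x IH|g x IH] v.
- by rewrite /tau !(pres_act1 right_module) mulr1.
- by rewrite /tau !(pres_actDl right_module) IHx IHy mulrDr.
- rewrite /tau !(pres_actZ right_module) IH; exact: pres_scalerAr.
- by rewrite /tau !(pres_actM right_module) IH !(pres_act_pi right_module) /= /right_gen mulrA.
Qed.

Lemma tauD : {morph tau : h h' / h + h'}.
Proof. by move=> h h'; exact: (pres_actDl right_module). Qed.

Lemma tauM h h' : tau (h * h') = tau h' * tau h.
Proof. by rewrite -tau_act; exact: (pres_actM right_module). Qed.

Lemma tau1 : tau 1 = 1.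
Proof. exact: (pres_act1 right_module). Qed.

Lemma tau_D s : tau (hD s) = hD s.
Proof. by rewrite /tau (pres_act_pi right_module) /= /right_gen mul1r. Qed.

Lemma tau_iota f : tau (iota f) = iota f.
Proof.
elim/Sym_gen_ind: f => [f g IHf IHg|c|t f IH].
- by rewrite rmorphD tauD; congr (_ + _); [exact: IHf|exact: IHg].
- rewrite iotaC /tau (pres_act_pi right_module) /=.
  exact: pres_mulr1.
- transitivity (iota f * iota (Sym_of (alpha k t))); last by rewrite -rmorphM mulrC.
  rewrite rmorphM tauM; congr (_ * _); first exact: IH.
  transitivity (tau (hV (alpha k t))); first by congr tau; exact: iota_of.
  rewrite /tau (pres_act_pi right_module) /= /right_gen mul1r.
  by symmetry; exact: iota_of.
Qed.

Section Pair.
Variables s t : S.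
Hypothesis neq_st : s <> t.
Hypothesis m_gt0 : (0 < m s t)%N.
Let l (b : bool) := if b then s else t.

Let m_gt1 : (1 < m s t)%N.
Proof. by have := mneq1 neq_st; lia. Qed.

Lemma left_word n b :
  npi (if b then braid_word k n s t else braid_word k n t s) =
  alt_word (fun b x => hD (l b) * x) (b (+) ~~ odd n) n 1.
Proof.
elim: n b => [|n IHn] b; first by case: b.
have -> : (if b then braid_word k n.+1 s t else braid_word k n.+1 t s) =
    TMul (TVar (GenD k (l b)))
      (if ~~ b then braid_word k n s t else braid_word k n t s) by case: b.
rewrite npi_mul IHn alt_word_recl.
by case: b => /=; case: (odd n) => /=.
Qed.

Lemma left_word_braid :
  alt_word (fun b x => hD (l b) * x) true (m s t) 1 =
  alt_word (fun b x => hD (l b) * x) false (m s t) 1.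
Proof.
have wt := left_word (m s t) true; have wf := left_word (m s t) false.
have := nilH_braid neq_st m_gt0; rewrite wt wf.
by case: (odd _) => /= ->.
Qed.

Lemma dem_indep (e : nat -> Sym) :
  (forall f, \sum_(j < (m s t).*2)
     e j * alt_word (fun b => dem (l b)) (odd j) (uphalf j) f = 0) ->
  forall j, (j < (m s t).*2)%N -> e j = 0.
Proof.
rewrite -(ltn_predK m_gt1) => sum0 j ltj.
apply: (alt_nth_indep (dem_pair k mss msym s t) (four_sub_cos2 k m_gt1) _ _ _ _ sum0) => //.
- by rewrite pnatr_eq0.
- by rewrite (ltn_predK m_gt1) cheb_frac_m.
- exact: cheb_frac_pred_m.
- by move=> i /andP[i_gt0 lei]; apply: cheb_frac_neq0 => //; rewrite i_gt0 /=; lia.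
Qed.

Lemma Dop_braid b x :
  alt_word (fun b => Dop (l b)) b (m s t) x =
  alt_word (fun b => Dop (l b)) (~~ b) (m s t) x.
Proof.
have br := Dword_braid nc pr (demM m) (demD m) m_gt0 left_word_braid
  (dem_braid mss msym m_gt1 true) dem_indep x.
by case: b => /=; [exact: br|symmetry; exact: br].
Qed.

End Pair.

Local Notation lactT := (@lactT Sym nilH iota).

Definition diag_gen (g : nilH_gen k S) : T -> T :=
  match g with GenV u => lactT (Sym_of u) | GenD s => Dop s end.

Lemma lactT0 x : lactT 0 x = 0.
Proof. by apply: (@addrI _ (lactT 0 x)); rewrite -lactT_add !addr0. Qed.

Lemma diag_module : term_module (fun c : k => lactT c%:MP) diag_gen (@nilH_rel k S m).
Proof.
split.
- by case=> [u|s]; [exact: lactTD|exact: (DopD nc)].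
- by move=> c; exact: lactTD.
- by move=> c c' v; rewrite monalgUD; exact: lactT_add.
- by move=> c c' v; rewrite mpolyCM; exact: lactT_mul.
- exact: lactT1.
- move=> c [u|s] v /=; first by rewrite -!lactT_mul mulrC.
  by rewrite (Dop_lactT nc) Sym_actC demC lactT0 addr0.
move=> a b; case=> {a b}.
- move=> c u w v /=; rewrite -lactT_mul -lactT_add; congr (lactT _ v).
  by rewrite mul_malgC; exact: linearP.
- move=> u w v; transitivity (lactT (Sym_of u * Sym_of w) v).
    by symmetry; exact: lactT_mul.
  by rewrite mulrC; exact: lactT_mul.
- by move=> s u v /=; rewrite (Dop_lactT nc) Sym_act_of dem_of.
- by move=> s v /=; rewrite (Dop_sq nc) malgC0E lactT0.
move=> s t neq m_gt0 v.
have bw b := @term_op_braid k S T (fun c => lactT c%:MP) diag_gen s t (m s t) b v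
  (@lactT1 _ _ iota).
transitivity (alt_word (fun b => Dop (if b then s else t)) (true (+) ~~ odd (m s t)) (m s t) v).
  exact: (bw true).
by rewrite (Dop_braid neq m_gt0) addTb !negbK; symmetry; exact: (bw false).
Qed.

Definition diag_act : nilH -> T -> T :=
  pres_act (fun c : k => lactT c%:MP) diag_gen (rel := @nilH_rel k S m).

Lemma diag_act_pi a x :
  diag_act (npi a) x = term_op (fun c : k => lactT c%:MP) diag_gen a x.
Proof. exact: (pres_act_pi diag_module). Qed.

Lemma diag_act_addl h h' x : diag_act (h + h') x = diag_act h x + diag_act h' x.
Proof. exact: (pres_actDl diag_module). Qed.

Lemma diag_act_mul h h' x : diag_act (h * h') x = diag_act h (diag_act h' x).
Proof. exact: (pres_actM diag_module). Qed.

Lemma diag_act_iota r x : diag_act (iota r) x = lactT r x.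
Proof.
elim/Sym_gen_ind: r => [r r' IH IH'|c|t r IH].
- rewrite rmorphD diag_act_addl lactT_add; congr (_ + _); [exact: IH|exact: IH'].
- by rewrite iotaC diag_act_pi.
- rewrite rmorphM diag_act_mul lactT_mul.
  transitivity (lactT (Sym_of (alpha k t)) (diag_act (iota r) x)).
    by rewrite iota_of; exact: diag_act_pi.
  by congr lactT; exact: IH.
Qed.

Lemma nilH_diagonal_action : diagonal_action al hD diag_act.
Proof.
split.
- exact: diag_act_addl.
- by move=> h x y; exact: (pres_actDr diag_module).
- by move=> x; exact: (pres_act1 diag_module).
- exact: diag_act_mul.
- exact: diag_act_iota.
- by move=> s x; exact: diag_act_pi.
Qed.

Lemma hwE s : hw iota al hD s = hW k m s.
Proof. by rewrite /hw /hW; congr (1 - _ * _); exact: iota_of. Qed.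

Lemma nilH_comul_diag : nilH_comul (diag diag_act).
Proof.
have D1 s : diag diag_act (hD s) = Dop s (otens iota 1 1) by exact: diag_act_pi.
split=> [u|s|s].
- transitivity (lactT (Sym_of u) (otens iota 1 1)); first exact: diag_act_pi.
  by rewrite lactT_otens mulr1; congr otens; exact: iota_of.
- by rewrite D1 (DopE' nc) !mulr1 hwE.
- by rewrite D1 (DopE nc) !mulr1 hwE.
Qed.

Lemma nilH_hopf : nilH_hopf_algebroid (diag diag_act) rho.
Proof.
split; [exact: rho_demazure|exact: nilH_comul_diag|].
exact: (diag_hopf nc pr nilH_diagonal_action (nilH_gen_ind (m := m))
  tauD tau1 tauM tau_iota tau_D).
Qed.

End NilHeckeHopf.

(** * The trace and the antipode *)


Section FractionField.
Variable A : comNzRingType.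
Hypothesis A_integral : forall x y : A, x * y = 0 -> (x == 0) || (y == 0).

(** The integrality proof is an argument of the type, so that structures depending on it can be
    attached to this copy of [A]. *)
Definition domain_copy (_ : forall x y : A, x * y = 0 -> (x == 0) || (y == 0)) : Type := A.
Local Notation B := (domain_copy A_integral).
HB.instance Definition _ := GRing.ComNzRing.on B.

Definition copy_unit : {pred B} := fun x => `[< exists y : B, y * x = 1 >].
Definition copy_inv (x : B) : B :=
  if pselect (exists y : B, y * x = 1) is left e then projT1 (cid e) else x.

Lemma copy_mulVx : {in copy_unit, left_inverse 1 copy_inv *%R}.
Proof.
move=> x /asboolP ux; rewrite /copy_inv.
by case: pselect => // e; exact: projT2 (cid e).
Qed.

Lemma copy_unitPl (x y : B) : y * x = 1 -> copy_unit x.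
Proof. by move=> yx; apply/asboolP; exists y. Qed.

Lemma copy_inv_out : {in [predC copy_unit], copy_inv =1 id}.
Proof.
move=> x /negP nux; rewrite /copy_inv; case: pselect => // e.
by case: nux; apply/asboolP.
Qed.

HB.instance Definition _ := GRing.ComNzRing_hasMulInverse.Build B
  copy_mulVx copy_unitPl copy_inv_out.
HB.instance Definition _ := GRing.ComUnitRing_isIntegral.Build B A_integral.

Lemma fraction_field_exists : exists (K : fieldType) (j : {rmorphism A -> K}), injective j.
Proof.
exists {fraction B}, (@FracField.tofrac B : {rmorphism B -> {fraction B}}) => x y /eqP.
by rewrite tofrac_eq => /eqP.
Qed.

End FractionField.

(** * The coefficient of the identity *)

Section Trace.
Variables (R : comNzRingType) (H : pzRingType) (iota : {rmorphism R -> H}).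
Variables (S : Type) (act dem : S -> R -> R) (al : S -> R) (D : S -> H).
Hypothesis nc : nil_cross iota act dem al D.
Variable rho : H -> R -> R.
Hypothesis pr : polynomial_rep iota dem D rho.
Hypothesis gen_ind : forall P : H -> Prop,
  P 1 -> (forall x y, P x -> P y -> P (x + y)) ->
  (forall r x, P x -> P (iota r * x)) ->
  (forall s x, P x -> P (D s * x)) -> forall x, P x.
Hypothesis actD : forall s, {morph act s : f g / f + g}.
Hypothesis actM : forall s, {morph act s : f g / f * g}.
Hypothesis act1 : forall s, act s 1 = 1.
Hypothesis actK : forall s, involutive (act s).
Hypothesis al_neq0 : forall s, al s != 0.
Variables (K : fieldType) (j : {rmorphism R -> K}).
Hypothesis j_inj : injective j.
Implicit Types (f g r : R) (phi psi : R -> K) (c q : K).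

Lemma j_eq0 f : (j f == 0) = (f == 0).
Proof. by rewrite -(rmorph0 j) (inj_eq j_inj). Qed.

(** An embedding of R in K; nonvanishing permits division by [chi (al s)] in [full_dem]. *)
Record point (chi : R -> K) : Prop := {
  ptD : {morph chi : f g / f + g};
  ptM : {morph chi : f g / f * g};
  pt_neq0 : forall f, f != 0 -> chi f != 0
}.

Lemma pointj : point j.
Proof. by split=> [f g|f g|f]; rewrite ?rmorphD ?rmorphM ?j_eq0. Qed.

Lemma point_act s chi : point chi -> point (fun f => chi (act s f)).
Proof.
move=> pt; split=> [f g|f g|f f_neq0]; rewrite ?actD ?actM ?(ptD pt) ?(ptM pt) //.
apply: (pt_neq0 pt); apply: contraNneq f_neq0 => f0.
by rewrite -(actK s f) f0 (morph_add0 (@actD s)).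
Qed.

(* [span P] is the K-span of the ring morphisms satisfying [P]. *)
Inductive span (P : (R -> K) -> Prop) : (R -> K) -> Prop :=
| span0 : span P (fun=> 0)
| spanS q chi phi : point chi -> P chi -> span P phi ->
    span P (fun f => q * chi f + phi f).

Local Notation off := (span (fun chi => chi <> j)).
Local Notation full := (span (fun=> True)).

Lemma eq_span P phi psi : phi =1 psi -> span P phi -> span P psi.
Proof. by move=> /funext ->. Qed.

Lemma spanD P phi psi : span P phi -> span P psi -> span P (fun f => phi f + psi f).
Proof.
move=> sphi spsi; elim: sphi => [|q chi phi' pt Pchi _ IH].
  by apply: eq_span spsi => f; rewrite add0r.
by apply: eq_span (spanS q pt Pchi IH) => f; rewrite addrA.
Qed.

Lemma spanZ P c phi : span P phi -> span P (fun f => c * phi f).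
Proof.
elim=> [|q chi phi' pt Pchi _ IH].
  by apply: eq_span (span0 P) => f; rewrite mulr0.
by apply: eq_span (spanS (c * q) pt Pchi IH) => f; rewrite mulrDr mulrA.
Qed.

Lemma span_mul P r phi : span P phi -> span P (fun f => phi (r * f)).
Proof.
elim=> [|q chi phi' pt Pchi _ IH]; first exact: span0.
by apply: eq_span (spanS (q * chi r) pt Pchi IH) => f; rewrite (ptM pt) mulrA.
Qed.

(** From alpha dem(f) = f - s(f), the composite of [chi] with [dem s] is the difference of [chi] and
    its composite with s, divided by [chi (al s)]. *)
Lemma full_dem s phi : full phi -> full (fun f => phi (dem s f)).
Proof.
elim=> [|q chi phi' pt _ _ IH]; first exact: span0.
have chi_al : chi (al s) != 0 by exact: (pt_neq0 pt).
apply: eq_span (spanS (q / chi (al s)) pt I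
  (spanS (- (q / chi (al s))) (point_act s pt) I IH)) => f.
rewrite addrA mulNr -mulrBr -(addrK (chi (act s f)) (chi f)).
have -> : chi f = chi (al s * dem s f) + chi (act s f).
  by rewrite -(ptD pt) (nc_demE nc) subrK.
by rewrite (ptM pt) !addrK mulrA divfK.
Qed.

Lemma full_rho h phi : full phi -> full (fun f => phi (rho h f)).
Proof.
elim/gen_ind: h phi => [|x y IHx IHy|r x IH|s x IH] phi fphi.
- by apply: eq_span fphi => f; rewrite (pr_1 pr).
- have -> : (fun f => phi (rho (x + y) f)) = (fun f => phi (rho x f) + phi (rho y f)).
    apply: funext => f; rewrite (pr_Dl pr); elim: fphi => [|q chi phi' pt _ _ IH].
      by rewrite addr0.
    by rewrite (ptD pt) IH mulrDr addrACA.
  by apply: spanD; [exact: IHx|exact: IHy].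
- apply: eq_span (IH _ (span_mul r fphi)) => f.
  by rewrite (pr_M pr) (pr_iota pr).
- apply: eq_span (IH _ (full_dem s fphi)) => f.
  by rewrite (pr_M pr) (pr_D pr).
Qed.

Lemma full_off phi : full phi -> exists c, off (fun f => phi f - c * j f).
Proof.
elim=> [|q chi phi' pt _ _ [c IH]].
  by exists 0; apply: eq_span (span0 _) => f; rewrite mul0r subr0.
have [chij|chij] := pselect (chi = j).
  exists (q + c); apply: eq_span IH => f.
  by rewrite chij mulrDl opprD addrACA subrr add0r.
by exists c; apply: eq_span (spanS q pt chij IH) => f; rewrite addrA.
Qed.

(* Dedekind independence, through an operator that kills [phi] and not [j]. *)
Lemma off_annihilator phi : off phi -> exists L : seq (K * R),
  (forall f, \sum_(p <- L) p.1 * phi (p.2 * f) = 0) /\ \sum_(p <- L) p.1 * j p.2 != 0.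
Proof.
elim=> [|q chi phi' pt chij _ [L [kill nz]]].
  exists [:: (1, 1)]; split=> [f|]; rewrite big_seq1 /= ?mulr0 //.
  by rewrite rmorph1 mulr1 oner_eq0.
have [g chig] : exists g, chi g <> j g.
  by apply: contrapT => /forallNP e; apply: chij; apply: funext => g; apply: contrapT; exact: e.
exists ([seq (p.1, p.2 * g) | p <- L] ++ [seq (- chi g * p.1, p.2) | p <- L]); split.
  move=> f; rewrite big_cat !big_map /= -big_split /=.
  rewrite (eq_bigr (fun p => p.1 * phi' (p.2 * (g * f)) - chi g * (p.1 * phi' (p.2 * f)))).
    by rewrite sumrB -mulr_sumr !kill mulr0 subr0.
  by move=> p _; rewrite !(ptM pt) !mulrA; ring.
rewrite big_cat !big_map /= -big_split /=.
rewrite (eq_bigr (fun p => (j g - chi g) * (p.1 * j p.2))).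
  rewrite -mulr_sumr mulf_neq0 // subr_eq0; apply/eqP => e; exact: chig.
by move=> p _; rewrite rmorphM; ring.
Qed.

Lemma off_j c : off (fun f => c * j f) -> c = 0.
Proof.
move=> /off_annihilator[L [kill nz]]; apply/eqP; move: (kill 1).
rewrite (eq_bigr (fun p => c * (p.1 * j p.2))) => [|p _]; last first.
  by rewrite mulr1 mulrCA.
by rewrite -mulr_sumr => /eqP; rewrite mulf_eq0 (negPf nz) orbF.
Qed.

Lemma trace_exists h : exists c, off (fun f => j (rho h f) - c * j f).
Proof.
apply: full_off; apply: full_rho.
apply: eq_span (spanS 1 pointj I (span0 _)) => f.
by rewrite mul1r addr0.
Qed.

(* The coefficient of the identity when [rho h] is written as a combination of
   ring automorphisms with coefficients in K. *)
Definition trace h : K := projT1 (cid (trace_exists h)).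

Lemma traceP h : off (fun f => j (rho h f) - trace h * j f).
Proof. exact: projT2 (cid (trace_exists h)). Qed.

Lemma trace_uniq h c : off (fun f => j (rho h f) - c * j f) -> trace h = c.
Proof.
move=> offc; apply/eqP; rewrite -subr_eq0; apply/eqP/off_j.
apply: eq_span (spanD offc (spanZ (- 1) (traceP h))) => f.
ring.
Qed.

Lemma eq_trace h h' : rho h =1 rho h' -> trace h = trace h'.
Proof. by move=> e; apply: trace_uniq; apply: eq_span (traceP h') => f; rewrite e. Qed.

Lemma traceD : {morph trace : h h' / h + h'}.
Proof.
move=> h h'; apply: trace_uniq; apply: eq_span (spanD (traceP h) (traceP h')) => f.
by rewrite (pr_Dl pr) rmorphD; ring.
Qed.

Lemma trace_iotal r h : trace (iota r * h) = j r * trace h.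
Proof.
apply: trace_uniq; apply: eq_span (spanZ (j r) (traceP h)) => f.
by rewrite (pr_M pr) (pr_iota pr) rmorphM; ring.
Qed.

(** Precomposition with multiplication by [r] preserves the span of the other morphisms. With
    [trace_iotal] this shows that the trace vanishes on commutators with R. *)
Lemma trace_iotar r h : trace (h * iota r) = j r * trace h.
Proof.
apply: trace_uniq; apply: eq_span (span_mul r (traceP h)) => f.
by rewrite (pr_M pr) (pr_iota pr) rmorphM; ring.
Qed.

Lemma trace1 : trace 1 = 1.
Proof.
apply: trace_uniq; apply: eq_span (span0 _) => f.
by rewrite (pr_1 pr) mul1r subrr.
Qed.

Hypothesis two_neq0 : 2%:R != 0 :> R.
Hypothesis act_dem : forall s r, act s (dem s r) = dem s r.
Local Notation hw := (@hw R H iota S al D).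

(** The relation s alpha = -alpha s gives 2 alpha tr(s) = 0. *)
Lemma trace_hw s : trace (hw s) = 0.
Proof.
have := trace_iotar (al s) (hw s); rewrite (hw_iota nc) trace_iotal (act_al nc).
rewrite rmorphN mulNr => /eqP; rewrite eq_sym -subr_eq0 opprK -mulr2n -mulr_natl.
rewrite mulf_eq0 mulf_eq0 j_eq0 (negPf (al_neq0 s)) orFb => /predU1P[two0|/eqP //].
by move: two_neq0; rewrite -j_eq0 rmorph_nat two0 eqxx.
Qed.

Lemma trace_iota r : trace (iota r) = j r.
Proof. by rewrite -[iota r]mulr1 trace_iotal trace1 mulr1. Qed.

(* [Y := al s * Z + 2 hw s], for [Z := hw s * (X + D s)], commutes with R, hence
   acts as multiplication by the polynomial [al s * rho Z 1 + 2]. *)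
Lemma trace_hw_sum_neq0 s X :
  (forall r, X * iota r = iota (act s r) * X + iota (dem s r)) ->
  (forall y, al s * y + 2%:R != 0) -> trace (hw s * (X + D s)) != 0.
Proof.
move=> Xcross nz; set Z := hw s * (X + D s).
(* From (X + D) r = s(r) (X + D) + 2 dem(r), multiplied by s on the left; the polynomial dem(r) is
   fixed by s and so commutes with it. *)
have ZC r : Z * iota r = iota r * Z + (iota (dem s r) * hw s + iota (dem s r) * hw s).
  rewrite /Z -mulrA [(X + D s) * _]mulrDl Xcross (nc_cross nc) addrACA -mulrDr [LHS]mulrDr.
  rewrite mulrA (hw_iota nc) actK -mulrA; congr (_ + _).
  by rewrite [LHS]mulrDr (hw_iota nc) act_dem.
clearbody Z.
move: (hw s) (hw_iota nc s) ZC (trace_hw s) (pr_hw nc pr s) => w wC ZC w0 rho_w.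
pose Y := iota (al s) * Z + (w + w).
(* The excess 2 alpha dem(r) s = 2 (r - s(r)) s of alpha Z is compensated by 2 s r = 2 s(r) s. *)
have YC r : Y * iota r = iota r * Y.
  rewrite /Y mulrDl -mulrA ZC mulrDl wC !mulrDr mulrA -rmorphM [al s * r]mulrC.
  rewrite rmorphM -mulrA -addrA; congr (_ + _).
  rewrite mulrA -rmorphM (nc_demE nc) addrACA -[X in X + _]mulrDl -rmorphD subrK.
  by rewrite -[X in _ + X = _]mulrDl -rmorphD subrK.
have YE : rho Y =1 rho (iota (rho Y 1)).
  move=> f; rewrite (pr_iota pr) -[f in LHS]mulr1 -(pr_iota pr f) -(pr_M pr) YC.
  by rewrite (pr_M pr) (pr_iota pr) mulrC.
have Y1 : rho Y 1 = al s * rho Z 1 + 2%:R.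
  rewrite (pr_Dl pr) (pr_M pr) (pr_iota pr); congr (_ + _).
  by rewrite (pr_Dl pr) rho_w act1.
apply: contraNneq (nz (rho Z 1)) => Z0; rewrite -Y1 -j_eq0 -trace_iota -(eq_trace YE).
by rewrite traceD trace_iotal Z0 mulr0 add0r traceD w0 addr0.
Qed.

Lemma central_trace_exists : exists tr : H -> K,
  [/\ {morph tr : h h' / h + h'}, forall r h, tr (iota r * h) = tr (h * iota r)
    & forall s X, (forall r, X * iota r = iota (act s r) * X + iota (dem s r)) ->
        (forall y, al s * y + 2%:R != 0) -> tr (hw s * (X + D s)) != 0].
Proof.
exists trace; split; [exact: traceD|move=> r h|exact: trace_hw_sum_neq0].
by rewrite trace_iotal trace_iotar.
Qed.

End Trace.

(** * Central functionals exclude an antipode *)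

Section CentralFunctional.
Variables (R : comPzRingType) (H : pzRingType) (iota : {rmorphism R -> H}).
Variables (Z : zmodType) (tr : H -> Z) (A : H -> H).
Hypothesis trD : {morph tr : h h' / h + h'}.
Hypothesis tr_central : forall r h, tr (iota r * h) = tr (h * iota r).
Hypothesis AD : {morph A : h h' / h + h'}.
Hypothesis AM : forall h h', A (h * h') = A h' * A h.
Hypothesis A_iota : forall r, A (iota r) = iota r.

(** Since A(rb) = A(b) r, centrality of [tr] carries [r] round to the left of [a]. *)
Lemma tr_opp_balanced : balanced (fun r => lact iota r) (fun r => lact iota r)
  (fun a b => tr (a * A b)).
Proof.
split=> [b a a'|a b b'|r a b].
- by rewrite mulrDl trD.
- by rewrite AD mulrDr trD.
- by rewrite /= /lact AM A_iota -mulrA tr_central mulrA.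
Qed.

Lemma tr_mul_balanced : balanced (fun r => ract iota r) (fun r => lact iota r)
  (fun a b => tr (a * b)).
Proof.
split=> [b a a'|a b b'|r a b].
- by rewrite mulrDl trD.
- by rewrite mulrDr trD.
- by rewrite /= /ract /lact mulrA.
Qed.

(* A functional vanishing on commutators with R does not see the expansion
   chosen in [induces_red]. *)
Lemma central_expansion (s : seq (H * H)) :
  tlift (fun a b => tr (a * A b)) (\sum_(p <- s) otens iota p.1 p.2) =
  tlift (fun a b => tr (a * b)) (\sum_(p <- s) btens iota p.1 (A p.2)).
Proof.
rewrite (morph_sum _ _ _ (tlift_add tr_opp_balanced)).
rewrite (morph_sum _ _ _ (tlift_add tr_mul_balanced)); apply: eq_bigr => p _.
by rewrite (tlift_pure tr_opp_balanced) (tlift_pure tr_mul_balanced).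
Qed.

End CentralFunctional.

Section NoAntipode.
Variables (k : realType) (S : choiceType) (m : S -> S -> nat).
Hypothesis mss : forall s, m s s = 1%N.
Hypothesis msym : forall s t, m s t = m t s.
Hypothesis mneq1 : forall s t, s <> t -> m s t != 1%N.
Local Notation Sym := (Sym k S).
Local Notation nilH := (nilH k m).
Local Notation iota := (@Sym_to_nilH k S m).
Local Notation hD := (@hD k S m).
Local Notation act := (@Sym_act k S m).
Local Notation dem := (@dem k S m).
Local Notation al := (fun s => Sym_of (alpha k s)).
Local Notation hw := (@hw Sym nilH iota S al hD).

Lemma al_mul_add2_neq0 (s : S) (y : Sym) : Sym_of (alpha k s) * y + 2%:R != 0.
Proof.
rewrite Sym_of_alpha -(mpolyC_nat {cmonom S} k 2).
by apply: ucm_mul_add_neq0; rewrite pnatr_eq0.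
Qed.

(** Applying [A] to the crossing relation at q reverses it: q A(D) = A(D) s(q) + dem(q). Taking q =
    s(r) and using dem(s(r)) = -dem(r) restores the original form. *)
Lemma antipode_cross (A : nilH -> nilH) s r : op_morphism_over_Sym A ->
  A (hD s) * iota r = iota (act s r) * A (hD s) + iota (dem s r).
Proof.
move=> opA; have AD : {morph A : h h' / h + h'}.
  by move=> h h'; have := op_linear opA 1 h h'; rewrite !scale1r.
have e q : iota q * A (hD s) = A (hD s) * iota (act s q) + iota (dem s q).
  have := congr1 A (hD_iota m s q); rewrite AD !(opM opA) !(op_id opA).
  exact.
have := e (act s r); rewrite (Sym_actK mss) (dem_act mss) rmorphN => ->.
by rewrite subrK.
Qed.

Lemma nilH_no_antipode (s : S) (Delta : nilH -> HoH iota) (eps : nilH -> Sym)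
    (red : nilH -> HbH iota) (A : nilH -> nilH) :
  nilH_comul Delta -> bialgebroid Delta eps -> is_red Delta red ->
  op_morphism_over_Sym A -> ~ induces_red Delta A red.
Proof.
move=> comul bi redP opA ind.
have nc := nilH_cross k mss; have pr := nilH_rep k mss msym mneq1.
have da := nilH_diagonal_action k mss msym mneq1.
have gi := @nilH_gen_ind k S m.
have DeltaE : Delta = diag (@diag_act k S m).
  apply: funext; apply: (diag_uniq nc da gi bi) => t.
  by rewrite (hwE k m); exact: (comulD' comul).
have redD : red (hD s) = btens iota (hD s) 1 - btens iota (hw s) (hD s).
  have redP' : is_red (diag (@diag_act k S m)) red by rewrite -DeltaE.
  exact: (red_D nc da gi (@tauD k S m mss) (@tau1 k S m mss)
    (@tauM k S m mss) (@tau_iota k S m mss) (@tau_D k S m mss) s redP').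
have [K [j j_inj]] := fraction_field_exists (@malg_cmonom_integral k S).
have two_neq0 : 2%:R != 0 :> Sym.
  by have := al_mul_add2_neq0 s 0; rewrite mulr0 add0r.
have [tr [trD trC tr_neq0]] := central_trace_exists nc pr gi (@Sym_actD k S m)
  (@Sym_actM k S m) (fun s => rmorph1 (act s)) (Sym_actK mss) (@alpha_neq0 k S) j_inj
  two_neq0 (Sym_act_dem mss).
have [r [Deltar redr]] := ind (hD s).
have AD : {morph A : h h' / h + h'}.
  by move=> h h'; have := op_linear opA 1 h h'; rewrite !scale1r.
have := central_expansion trD trC AD (opM opA) (op_id opA) r.
rewrite -Deltar -redr (comulD' comul) redD.
have oD := tlift_add (tr_opp_balanced trD trC AD (opM opA) (op_id opA)).
have oE := tlift_pure (tr_opp_balanced trD trC AD (opM opA) (op_id opA)).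
have mD := tlift_add (tr_mul_balanced iota trD).
have mE := tlift_pure (tr_mul_balanced iota trD).
have -> : - btens iota (hw s) (hD s) = btens iota (- hw s) (hD s).
  by symmetry; exact: pureNl.
(* Both sides contain tr(D), coming from D (x) 1 and D [x] 1; what is left is tr(s A(D)) = tr(-s D),
   contradicting [tr_neq0] for X = A(D). *)
rewrite oD mD !oE !mE (op1 opA) -(hwE k m) => /addrI e.
have := tr_neq0 s (A (hD s)) (fun r => antipode_cross s r opA) (al_mul_add2_neq0 s).
rewrite mulrDr trD e -trD mulNr addNr => /eqP; apply; exact: morph_add0 trD.
Qed.

End NoAntipode.

Theorem corollary4p20 (k : realType) (W : groupType) (S : choiceType)
    (sigma : S -> W) (m : S -> S -> nat)
    (cox : coxeter_system sigma m) (s0 : S) :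
  (exists (Delta : nilH k m -> nilHoH k m) (rho : nilH k m -> Sym k S -> Sym k S),
      nilH_hopf_algebroid Delta rho) /\
  (forall (Delta : nilH k m -> nilHoH k m) (rho : nilH k m -> Sym k S -> Sym k S),
      nilH_hopf_algebroid Delta rho ->
      forall red : nilH k m -> nilHbH k m, is_red Delta red ->
      forall S_H : nilH k m -> nilH k m, op_morphism_over_Sym S_H ->
      ~ induces_red Delta S_H red).
Proof.
have mss := coxeter_diag cox; have msym := coxeter_sym cox.
have mneq1 := coxeter_neq1 cox.
split; first by exists (diag (@diag_act k S m)), (@rho k S m); exact: nilH_hopf.
move=> Delta rho' [_ comul [bi _]] red redP A opA.
exact: (nilH_no_antipode mss msym mneq1 s0 comul bi redP opA).
Qed.
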